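(* Let $f:\mathbb{R}^D\to\mathbb{R}$ be continuous with effective dimension $d_e$, $d_e<D$ and $d_e\le d$, with effective subspace $\mathcal{T}$ and constant subspace $\mathcal{T}^\perp$ spanned by the columns of the orthonormal matrices $U\in\mathbb{R}^{D\times d_e}$ and $V\in\mathbb{R}^{D\times(D-d_e)}$, respectively. Let $\boldsymbol{x}^*$ be any global minimizer of $f$ over $\mathcal{X}=[-1,1]^D$, let $\boldsymbol{p}\in\mathcal{X}$ be a given vector, and let $A$ be a $D\times d$ Gaussian matrix. Assume that $\boldsymbol{p}_\top\neq\boldsymbol{x}^*_\top$. Then $$\mathbb{P}[(\mathrm{RP}\mathcal{X})\text{ is successful}]\ \ge\ \mathbb{P}\left(-\boldsymbol{1}\le\boldsymbol{x}^*_\top+\boldsymbol{p}_\perp+V\boldsymbol{w}\le\boldsymbol{1}\right),$$ where $\boldsymbol{w}$ is a random vector that follows a $(D-d_e)$-dimensional $t$-distribution with parameters $d-d_e+1$ and $\frac{\|\boldsymbol{x}_\top^*-\boldsymbol{p}_\top\|^2}{d-d_e+1}I$.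
   Context: A function $f:\mathbb{R}^D\to\mathbb{R}$ has effective dimension $d_e$ if there is a linear subspace $\mathcal{T}$ of dimension $d_e$ such that $f(\boldsymbol{x}_\top+\boldsymbol{x}_\perp)=f(\boldsymbol{x}_\top)$ for all $\boldsymbol{x}_\top\in\mathcal{T}$ and $\boldsymbol{x}_\perp\in\mathcal{T}^\perp$, and $d_e$ is the smallest integer with this property. $\mathcal{T}$ and $\mathcal{T}^\perp$ are called the effective and constant subspaces of $f$. For $\boldsymbol{x}\in\mathbb{R}^D$, $\boldsymbol{x}_\top=UU^T\boldsymbol{x}$ and $\boldsymbol{x}_\perp=VV^T\boldsymbol{x}$ denote the Euclidean projections onto $\mathcal{T}$ and $\mathcal{T}^\perp$. A Gaussian matrix is a random matrix with independent $\mathcal{N}(0,1)$ entries. $\|\cdot\|$ is the Euclidean norm, $\boldsymbol{1}$ is the all-ones vector, and vector inequalities are componentwise. Let $f^*=\min_{\boldsymbol{x}\in\mathcal{X}}f(\boldsymbol{x})$. The reduced problem $(\mathrm{RP}\mathcal{X})$ is: minimize $f(A\boldsymbol{y}+\boldsymbol{p})$ over $\boldsymbol{y}\in\mathbb{R}^d$ subject to $A\boldsymbol{y}+\boldsymbol{p}\in\mathcal{X}$. It is successful if there exists $\boldsymbol{y}^*\in\mathbb{R}^d$ with $f(A\boldsymbol{y}^*+\boldsymbol{p})=f^*$ and $A\boldsymbol{y}^*+\boldsymbol{p}\in\mathcal{X}$. An $l$-dimensional random vector has the $t$-distribution with parameters $\nu$ and $\Sigma$ if its density is $\frac{1}{(\pi\nu)^{l/2}}\frac{\Gamma((l+\nu)/2)}{\Gamma(\nu/2)}\det(\Sigma)^{-1/2}\left(1+\frac1\nu\boldsymbol{t}^T\Sigma^{-1}\boldsymbol{t}\right)^{-(l+\nu)/2}$.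 *)

(* Defs.v *)
From HB Require Import structures.
From mathcomp Require Import all_boot all_order all_algebra.
From mathcomp Require Import all_classical all_reals all_analysis.

Set Implicit Arguments.
Unset Strict Implicit.
Unset Printing Implicit Defensive.

Import Order.TTheory GRing.Theory Num.Theory.
Import numFieldNormedType.Exports.

Local Open Scope classical_set_scope.
Local Open Scope ring_scope.

Section euclidean.
Context {R : realType} {D : nat}.
Implicit Types (x y : 'cV[R]_D) (f : 'cV[R]_D -> R) (T : {vspace 'cV[R]_D}).

Definition dotmul x y : R := (x^T *m y) 0 0.

(* Not `|x|, which on matrices is the sup norm. *)
Definition enorm x : R := Num.sqrt (dotmul x x).

Definition orthogonal_complement T : set 'cV[R]_D :=
  [set x : 'cV[R]_D | forall t, t \in T -> dotmul t x = 0].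

Definition colspan k (M : 'M[R]_(D, k)) : {vspace 'cV[R]_D} :=
  <<[seq col j M | j <- enum 'I_k]>>%VS.

Definition orthonormal_columns k (M : 'M[R]_(D, k)) : Prop := M^T *m M = 1%:M.

(* The Euclidean projection onto colspan M when M has orthonormal columns. *)
Definition projection k (M : 'M[R]_(D, k)) x : 'cV[R]_D := M *m M^T *m x.

Definition effective_subspace f (k : nat) T : Prop :=
  \dim T = k /\
  forall xt xp : 'cV[R]_D,
    xt \in T -> orthogonal_complement T xp -> f (xt + xp) = f xt.

Definition effective_dimension f (k : nat) : Prop :=
  (exists T, effective_subspace f k T) /\
  (forall k' : nat, (exists T, effective_subspace f k' T) -> (k <= k')%N).

Definition cube : set 'cV[R]_D :=
  [set x : 'cV[R]_D | forall i, -1 <= x i 0 <= 1].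

Definition global_minimizer f (X : set 'cV[R]_D) x : Prop :=
  X x /\ forall z, X z -> f x <= f z.

Definition minimum_value f (X : set 'cV[R]_D) (m : R) : Prop :=
  (f @` X) m /\ lbound (f @` X) m.

(* The reduced problem: minimize f (A y + p) over y subject to A y + p in X;
   fstar is the minimum of f over X. *)
Definition reduced_problem_successful d f (X : set 'cV[R]_D) (fstar : R)
    (A : 'M[R]_(D, d)) (p : 'cV[R]_D) : Prop :=
  exists y : 'cV[R]_d, f (A *m y + p) = fstar /\ X (A *m y + p).

End euclidean.
Arguments cube {R} D.

Section random_matrices.
Context {R : realType} {dO : measure_display} {O : measurableType dO}.
Variable P : probability O R.

Definition mutually_independent (I : finType) d' (T' : measurableType d')
    (X : I -> {RV P >-> T'}) : Prop :=
  forall (J : {set I}) (B : I -> set T'), (forall i, measurable (B i)) ->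
    P (\bigcap_(i in [set` J]) (X i @^-1` B i)) =
    (\prod_(i in J) P (X i @^-1` B i))%E.

Definition random_matrix m n (A : 'I_m * 'I_n -> {RV P >-> measurableTypeR R})
    (om : O) : 'M[R]_(m, n) :=
  \matrix_(i, j) A (i, j) om.

Definition gaussian_matrix m n
    (A : 'I_m * 'I_n -> {RV P >-> measurableTypeR R}) : Prop :=
  mutually_independent A /\
  forall ij B, measurable B -> distribution P (A ij) B = normal_prob 0 1 B.

End random_matrices.

Section lebesgue_measure_tuple.
Context {R : realType}.
Local Notation mR := (measurableTypeR R).

Definition cons_pair n (xt : mR * n.-tuple mR) : n.+1.-tuple mR :=
  [tuple of xt.1 :: xt.2].

Lemma measurable_cons_pair n :
  measurable_fun [set: mR * n.-tuple mR] (@cons_pair n).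
Proof. exact: measurable_cons. Qed.

Section sigma_finite_step.
Variables (n : nat) (mu : {sigma_finite_measure set (n.-tuple mR) -> \bar R}).

Definition lebesgue_step : set (n.+1.-tuple mR) -> \bar R :=
  pushforward (@lebesgue_measure R \x mu)%E (@cons_pair n).

Let lebesgue_step0 : lebesgue_step set0 = 0%E.
Proof. by rewrite /lebesgue_step /pushforward preimage_set0 measure0. Qed.

Let lebesgue_step_ge0 A : (0 <= lebesgue_step A)%E.
Proof. by rewrite /lebesgue_step /pushforward; exact: measure_ge0. Qed.

Let lebesgue_step_sigma_additive : semi_sigma_additive lebesgue_step.
Proof.
apply: (@measure_semi_sigma_additive _ _ _ (pushforward _ _)).
exact: measurable_cons_pair.
Qed.

HB.instance Definition _ := isMeasure.Build _ _ _ lebesgue_step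
  lebesgue_step0 lebesgue_step_ge0 lebesgue_step_sigma_additive.

Lemma lebesgue_step_sigma_finite : sigma_finite setT lebesgue_step.
Proof.
have /sigma_finiteP[F [TF ndF Foo]] := sigma_finiteT (@lebesgue_measure R).
have /sigma_finiteP[G [TG ndG Goo]] := sigma_finiteT mu.
pose u (t : n.+1.-tuple mR) : mR * n.-tuple mR := (thead t, [tuple of behead t]).
have uK : cancel (@cons_pair n) u.
  by move=> [x t]; rewrite /u /cons_pair /= theadE; congr pair; exact: val_inj.
have mu_ : measurable_fun setT u.
  apply: measurable_fun_pair; first exact: measurable_tnth.
  exact: measurable_behead.
exists (fun k => u @^-1` (F k `*` G k)).
  rewrite -preimage_bigcup (_ : \bigcup_k _ = setT) ?preimage_setT//.
  apply/seteqP; split => // -[x t] _.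
  have [k _ Fkx] : (\bigcup_k F k) x by rewrite -TF.
  have [l _ Glt] : (\bigcup_k G k) t by rewrite -TG.
  exists (maxn k l) => //; split => /=.
    by move: x Fkx; exact/subsetPset/ndF/leq_maxl.
  by move: t Glt; exact/subsetPset/ndG/leq_maxr.
move=> k; have [mFk Fk] := Foo k; have [mGk Gk] := Goo k; split.
  by rewrite -[X in measurable X]setTI; apply: mu_ => //; exact: measurableX.
rewrite /lebesgue_step /pushforward (_ : _ @^-1` _ = F k `*` G k); last first.
  by apply/funext => z; rewrite /preimage /mkset uK.
by rewrite product_measure1E// lte_mul_pinfty// ge0_fin_numE.
Qed.

HB.instance Definition _ := Measure_isSigmaFinite.Build _ _ _
  lebesgue_step lebesgue_step_sigma_finite.

End sigma_finite_step.

(* Lebesgue measure on R^n, with R^n represented by n-tuples: the product of n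
   copies of the Lebesgue measure on R. *)
Fixpoint lebesgue_measure_tuple (n : nat) :
    {sigma_finite_measure set (n.-tuple mR) -> \bar R} :=
  match n with
  | 0 => \d_ [tuple]
  | m.+1 => lebesgue_step (lebesgue_measure_tuple m)
  end.

End lebesgue_measure_tuple.

Section t_distribution.
Context {R : realType}.

Definition Gamma (a : R) : R :=
  \int[lebesgue_measure]_(x in `]0, +oo[) (x `^ (a - 1) * expR (- x)).

Definition col_of_tuple l (t : l.-tuple R) : 'cV[R]_l := \col_i tnth t i.

Definition t_pdf l (nu : R) (Sigma : 'M[R]_l) (t : 'cV[R]_l) : R :=
  ((pi * nu) `^ (l%:R / 2))^-1 *
  (Gamma ((l%:R + nu) / 2) / Gamma (nu / 2)) *
  (\det Sigma) `^ (- (1 / 2)) *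
  (1 + nu^-1 * (t^T *m invmx Sigma *m t) 0 0) `^ (- ((l%:R + nu) / 2)).

Definition follows_t dO (O : measurableType dO) (P : probability O R) l
    (nu : R) (Sigma : 'M[R]_l)
    (w : {RV P >-> l.-tuple (measurableTypeR R)}) : Prop :=
  forall B, measurable B ->
    distribution P w B =
    (\int[lebesgue_measure_tuple l]_(t in B)
       (t_pdf nu Sigma (col_of_tuple t))%:E)%E.

End t_distribution.

(* Main.v *)
(** Rotate coordinates so that the first direction of the frame of the effective
    subspace is u = (x*_T - p_T) / s, with s = |x*_T - p_T|. The Gaussian matrix A
    then splits into independent Gaussian blocks: r (the other d_e - 1 directions
    of the effective subspace), the row b = u^T A and C = V^T A. If r y = 0,
    b y = s and x*_T + p_perp + V C y is in the cube, then y is a solution of the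
    reduced problem. Given r, let G be a matrix with d - d_e + 1 orthonormal rows,
    orthogonal to the rows of r. Then h = b G^T is a standard Gaussian vector,
    y = s G^T h^T / |h|^2 satisfies the first two conditions, and given h the law
    of C y is that of s / |h| times a standard Gaussian vector independent of h.
    Such a mixture has density proportional to that of the t-distribution, and
    the constants agree because both measures have total mass 1. *)

Require Import Defs.
From HB Require Import structures.
From mathcomp Require Import all_boot all_order all_algebra.
From mathcomp Require Import all_classical all_reals all_analysis measurable_realfun.
From mathcomp Require Import ring lra zify.

Set Implicit Arguments.
Unset Strict Implicit.
Unset Printing Implicit Defensive.

Import Order.TTheory GRing.Theory Num.Theory.
Import numFieldNormedType.Exports.

Local Open Scope classical_set_scope.
Local Open Scope ring_scope.

(** All probabilities are turned into integrals against [lebesgue_measure_tuple], where two kinds of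
    substitution suffice: affine maps with a positive dilation factor, and orthogonal maps. Polar
    coordinates are avoided. Conditioning on the blocks [r] and [b] is replaced by Tonelli together
    with an inner bound that holds for every value of the outer variables. Hence [G] and [y] may be
    chosen separately for each sample, without a measurable selection, and also where [r] has
    deficient rank. The event of success quantifies over all [y], so its measurability is an
    obstacle of its own; compactness reduces it to countably many rational conditions. The number d
    - d_e + 1 is the least possible dimension of the kernel of a matrix with d_e - 1 rows and d
    columns, which is why it becomes the number of degrees of freedom. The result is an inequality
    because a single [y] is tested per sample, and success may come from another one. *)

Local Notation mR R := (measurableTypeR R).

(** * Affine substitution on the real line *)

Section one_dimensional_lebesgue.
Context {R : realType}.
Local Open Scope ereal_scope.

Lemma measurable_affine (c v : R) :
  measurable_fun [set: mR R] (fun x : mR R => (c * x + v)%R : mR R).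
Proof.
apply: measurable_funD; last exact: measurable_cst.
by apply: measurable_funM => //; exact: measurable_cst.
Qed.

(** Both sides are measures in [A] that agree on the intervals []a, b]], which determine Lebesgue
    measure. *)
Lemma lebesgue_measure_affine (c v : R) (A : set (mR R)) : (0 < c)%R ->
  measurable A ->
  lebesgue_measure A =
  c%:E * lebesgue_measure ((fun x => c * x + v)%R @^-1` A).
Proof.
move=> c0 mA.
have c00 : (0 <= c)%R by exact: ltW.
pose mf : measurable_fun [set: mR R] (fun x : mR R => (c * x + v)%R : mR R) :=
  measurable_affine c v.
pose g (x : mR R) : mR R := (c * x + v)%R.
pose mu_ : {measure set (mR R) -> \bar R} :=
  mscale (NngNum c00) (pushforward (@lebesgue_measure R) g).
pose mu := mu_ mf.
suff -> : lebesgue_measure A = mu A by [].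
apply: lebesgue_measure_unique => // X [[a b] _ <-].
have gE : g @^-1` `]a, b]%classic = `]((a - v) / c)%R, ((b - v) / c)%R]%classic.
  apply/seteqP; split => x; rewrite /= !in_itv/= ltr_pdivrMr// ler_pdivlMr//;
  by rewrite ltrBlDr lerBrDr (mulrC x).
transitivity (c%:E * lebesgue_measure (g @^-1` `]a, b]%classic)) => //.
rewrite gE !lebesgue_measure_itv/= !lte_fin.
rewrite ltr_pM2r ?invr_gt0// ltrD2r.
case: ifP => _; last by rewrite mule0.
rewrite -!EFinB -EFinM; congr EFin.
by rewrite -mulrBl mulrCA mulfV ?gt_eqF// mulr1; ring.
Qed.

Lemma ge0_integral_affine (c v : R) (f : mR R -> \bar R) : (0 < c)%R ->
  measurable_fun setT f -> (forall x, 0 <= f x) ->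
  \int[lebesgue_measure]_x f x =
  c%:E * \int[lebesgue_measure]_x f (c * x + v)%R.
Proof.
move=> c0 mf f0.
have c00 : (0 <= c)%R by exact: ltW.
pose mg : measurable_fun [set: mR R] (fun x : mR R => (c * x + v)%R : mR R) :=
  measurable_affine c v.
pose g (x : mR R) : mR R := (c * x + v)%R.
pose mu_ : {measure set (mR R) -> \bar R} :=
  mscale (NngNum c00) (pushforward (@lebesgue_measure R) g).
pose mu := mu_ mg.
transitivity (\int[mu]_x f x).
  by apply: eq_measure_integral => A mA _; exact: lebesgue_measure_affine.
rewrite ge0_integral_mscale// ge0_integral_pushforward//=.
Qed.

End one_dimensional_lebesgue.

(** * Passage between tuples and row vectors *)

Section tuples_as_rows.
Context {R : realType}.

(** Tuples carry the product sigma-algebra and Lebesgue measure, rows the matrix algebra and the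
    topology; hence two representations of the same vectors. *)
Definition row_of_tuple n (t : n.-tuple (mR R)) : 'rV[R]_n := \row_i tnth t i.

Definition tuple_of_row n (v : 'rV[R]_n) : n.-tuple (mR R) :=
  [tuple (v 0 i : mR R) | i < n].

Lemma row_of_tupleK n : cancel (@row_of_tuple n) (@tuple_of_row n).
Proof. by move=> t; apply: eq_from_tnth => i; rewrite tnth_mktuple mxE. Qed.

Lemma tuple_of_rowK n : cancel (@tuple_of_row n) (@row_of_tuple n).
Proof. by move=> v; apply/rowP => i; rewrite mxE tnth_mktuple. Qed.

Lemma row_of_tuple_cons n (x : mR R) (t : n.-tuple (mR R)) :
  row_of_tuple (cons_pair (x, t)) = row_mx (x%:M) (row_of_tuple t) :> 'rV_(1 + n).
Proof.
apply/rowP => i; rewrite [LHS]mxE; case: (split_ordP i) => j -> /=.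
  by rewrite row_mxEl (ord1 j) mxE eqxx mulr1n.
by rewrite row_mxEr mxE (_ : rshift 1 j = lift ord0 j) ?tnthS//; exact: val_inj.
Qed.

Lemma row_of_tuple_cat m n (x : m.-tuple (mR R)) (y : n.-tuple (mR R)) :
  row_of_tuple [tuple of x ++ y] = row_mx (row_of_tuple x) (row_of_tuple y).
Proof.
apply/rowP => i; rewrite [LHS]mxE; case: (split_ordP i) => j -> /=.
  by rewrite row_mxEl mxE tnth_lshift.
by rewrite row_mxEr mxE tnth_rshift.
Qed.

Lemma measurable_tuple_of_row d (T : measurableType d) n (F : T -> 'rV[R]_n) :
  (forall i, measurable_fun setT (fun x => F x 0 i : mR R)) ->
  measurable_fun setT (fun x => tuple_of_row (F x)).
Proof.
move=> mF; apply/measurable_fun_tnthP => i.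
rewrite (_ : _ \o _ = fun x => F x 0 i) //.
by apply/funext => x /=; rewrite tnth_mktuple.
Qed.

Lemma measurable_row_coord n (i : 'I_n) :
  measurable_fun setT (fun t : n.-tuple (mR R) => row_of_tuple t 0 i : mR R).
Proof. by under eq_fun do rewrite mxE; exact: measurable_tnth. Qed.

Lemma measurable_row_mulmx d (T : measurableType d) n k (F : T -> 'rV[R]_n)
    (M : 'M[R]_(n, k)) i :
  (forall i, measurable_fun setT (fun x => F x 0 i : mR R)) ->
  measurable_fun setT (fun x => (F x *m M) 0 i : mR R).
Proof.
move=> mF; under eq_fun do rewrite mxE.
apply: (@measurable_sum _ T R) => j; apply: measurable_funM; first exact: mF.
exact: measurable_cst.
Qed.

End tuples_as_rows.

Section parametric_integral.
Context {R : realType} d1 d2 (T1 : measurableType d1) (T2 : measurableType d2).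
Local Open Scope ereal_scope.

Lemma measurable_parametric_integral
    (mu : {sigma_finite_measure set T2 -> \bar R}) (f : T1 -> T2 -> \bar R) :
  measurable_fun setT (fun p => f p.1 p.2) -> (forall x y, 0 <= f x y) ->
  measurable_fun setT (fun x => \int[mu]_y f x y).
Proof.
move=> mf f0.
exact: (@measurable_fun_fubini_tonelli_F _ _ _ _ R mu (fun p => f p.1 p.2)).
Qed.

End parametric_integral.

(** * Iterated integrals and affine substitution in several variables *)

Section lebesgue_tuple.
Context {R : realType}.
Local Notation leb := (@lebesgue_measure_tuple R).
Local Open Scope ereal_scope.

Lemma measurable_cat_tuple m n :
  measurable_fun setT (fun p : m.-tuple (mR R) * n.-tuple (mR R) =>
    [tuple of p.1 ++ p.2] : (m + n).-tuple (mR R)).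
Proof.
apply/measurable_fun_tnthP => i; case: (split_ordP i) => j ->.
  rewrite (_ : _ \o _ = (@tnth _ _ ^~ j) \o fst).
    by apply: measurableT_comp => //; exact: measurable_tnth.
  by apply/funext => p; rewrite /= tnth_lshift.
rewrite (_ : _ \o _ = (@tnth _ _ ^~ j) \o snd).
  by apply: measurableT_comp => //; exact: measurable_tnth.
by apply/funext => p; rewrite /= tnth_rshift.
Qed.

Lemma ge0_integral_leb0 (f : 0.-tuple (mR R) -> \bar R) :
  (forall t, 0 <= f t) ->
  \int[leb 0]_t f t = f [tuple].
Proof.
move=> f0; rewrite /lebesgue_measure_tuple.
rewrite (eq_integral (cst (f [tuple]))) ; last by move=> t _; rewrite tuple0.
rewrite integral_cst//= diracE mem_set// mule1//.
Qed.

Lemma ge0_integral_lebS n (f : n.+1.-tuple (mR R) -> \bar R) :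
  measurable_fun setT f -> (forall t, 0 <= f t) ->
  \int[leb n.+1]_t f t =
  \int[lebesgue_measure]_x \int[leb n]_t f (cons_pair (x, t)).
Proof.
move=> mf f0.
transitivity (\int[pushforward (lebesgue_measure \x leb n)%E (@cons_pair R n)]_t f t).
  by [].
rewrite (ge0_integral_pushforward (@measurable_cons_pair R n))// preimage_setT.
rewrite fubini_tonelli1// => [|z]; last exact: f0.
by apply: measurableT_comp => //; exact: measurable_cons_pair.
Qed.

Lemma measurable_fun_cons n (f : n.+1.-tuple (mR R) -> \bar R) x :
  measurable_fun setT f ->
  measurable_fun setT (fun t : n.-tuple (mR R) => f (cons_pair (x, t))).
Proof.
move=> mf; apply: measurableT_comp => //.
exact: (measurableT_comp (@measurable_cons_pair R n) (pair1_measurable x)).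
Qed.

Lemma measurable_fun_cat m n (f : (m + n).-tuple (mR R) -> \bar R)
    (x : m.-tuple (mR R)) :
  measurable_fun setT f ->
  measurable_fun setT (fun t : n.-tuple (mR R) => f [tuple of x ++ t]).
Proof.
move=> mf; apply: measurableT_comp => //.
exact: (measurableT_comp (@measurable_cat_tuple m n) (pair1_measurable x)).
Qed.

Lemma measurable_fun_cat_integral m n (f : (m + n).-tuple (mR R) -> \bar R) :
  measurable_fun setT f -> (forall t, 0 <= f t) ->
  measurable_fun setT (fun t : m.-tuple (mR R) => \int[leb n]_y f [tuple of t ++ y]).
Proof.
move=> mf f0.
apply: measurable_parametric_integral => //.
by apply: measurableT_comp => //; exact: measurable_cat_tuple.
Qed.

Lemma ge0_integral_leb_cat m n (f : (m + n).-tuple (mR R) -> \bar R) :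
  measurable_fun setT f -> (forall t, 0 <= f t) ->
  \int[leb (m + n)]_t f t =
  \int[leb m]_x \int[leb n]_y f [tuple of x ++ y].
Proof.
elim: m f => [|m IH] f mf f0.
  rewrite ge0_integral_leb0; last by move=> t; exact: integral_ge0.
  by apply: eq_integral => t _; congr f; exact: val_inj.
rewrite ge0_integral_lebS; last 2 first.
- exact: measurable_fun_cat_integral.
- by move=> t; exact: integral_ge0.
transitivity (\int[lebesgue_measure]_x \int[leb (m + n)]_t f (cons_pair (x, t))).
  exact: (@ge0_integral_lebS (m + n)).
apply: eq_integral => x _; rewrite IH//; last first.
  exact: (@measurable_fun_cons (m + n)).
apply: eq_integral => t _; apply: eq_integral => y _.
by congr f; exact: val_inj.
Qed.

(** Induction on the coordinates, each of which contributes one factor [c]. It serves twice: for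
    translations ([c] = 1) and for dilations ([v] = 0). *)
Lemma ge0_integral_leb_affine n (c : R) (v : 'rV[R]_n)
    (f : n.-tuple (mR R) -> \bar R) : (0 < c)%R ->
  measurable_fun setT f -> (forall t, 0 <= f t) ->
  \int[leb n]_t f t =
  (c ^+ n)%:E *
    \int[leb n]_t f (tuple_of_row (c *: row_of_tuple t + v)%R).
Proof.
move=> c0.
have maff k (w : 'rV[R]_k) :
    measurable_fun setT (fun t => tuple_of_row (c *: row_of_tuple t + w)%R).
  apply: measurable_tuple_of_row => i; under eq_fun do rewrite !mxE.
  apply: measurable_funD; last exact: measurable_cst.
  apply: measurable_funM; first exact: measurable_cst.
  exact: measurable_tnth.
elim: n v f => [|n IH] v f mf f0.
  rewrite !ge0_integral_leb0//.
  by rewrite expr0 mul1e; congr f; exact/esym/tuple0.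
pose v1 : 'rV[R]_(1 + n) := v.
rewrite !ge0_integral_lebS//; last first.
  by apply: measurableT_comp => //; exact: maff.
pose F (x : mR R) := \int[leb n]_t f (cons_pair (x, t)).
have mF : measurable_fun setT F.
  apply: measurable_parametric_integral => //.
  by apply: measurableT_comp => //; exact: measurable_cons_pair.
have F0 x : 0 <= F x by exact: integral_ge0.
rewrite (ge0_integral_affine (v 0 0)%R c0 mF F0).
have Fx x : F (c * x + v 0 0)%R = (c ^+ n)%:E * \int[leb n]_t
    f (tuple_of_row (c *: row_of_tuple (cons_pair (x, t)) + v)%R).
  rewrite /F (IH (rsubmx v1))//; last exact: measurable_fun_cons.
  congr (_ * _); apply: eq_integral => t _; congr f.
  apply: eq_from_tnth => i; rewrite tnth_mktuple.
  case: (unliftP ord0 i) => [j ->|->].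
    rewrite tnthS tnth_mktuple !mxE tnthS; congr (_ + v _ _)%R.
    exact: val_inj.
  by rewrite /tnth/= !mxE.
under eq_integral do rewrite Fx.
rewrite ge0_integralZl//; last 3 first.
- apply: measurable_parametric_integral => //.
  apply: measurableT_comp => //.
  exact: (measurableT_comp (@maff n.+1 v) (@measurable_cons_pair R n)).
- by move=> x _; exact: integral_ge0.
- by rewrite lee_fin exprn_ge0// ltW.
by rewrite muleA -EFinM -exprS.
Qed.

End lebesgue_tuple.

(** * The standard Gaussian density and its rotation invariance *)

Section gaussian_density.
Context {R : realType}.
Local Notation leb := (@lebesgue_measure_tuple R).

Definition sqnorm n (v : 'rV[R]_n) : R := (v *m v^T) 0 0.

Lemma sqnormE n (v : 'rV[R]_n) : sqnorm v = \sum_i v 0 i ^+ 2.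
Proof. by rewrite /sqnorm mxE; apply: eq_bigr => i _; rewrite mxE expr2. Qed.

Lemma sqnorm_ge0 n (v : 'rV[R]_n) : 0 <= sqnorm v.
Proof. by rewrite sqnormE; apply: sumr_ge0 => i _; exact: sqr_ge0. Qed.

Lemma sqnorm_eq0 n (v : 'rV[R]_n) : (sqnorm v == 0) = (v == 0).
Proof.
apply/eqP/eqP => [|->]; last by rewrite /sqnorm mul0mx mxE.
rewrite sqnormE => /eqP; rewrite psumr_eq0; last by move=> i _; exact: sqr_ge0.
move=> /allP v0; apply/rowP => i; rewrite mxE.
by have /(_ (mem_index_enum _))/implyP/(_ isT) := v0 i; rewrite sqrf_eq0 => /eqP.
Qed.

Lemma sqnormN n (v : 'rV[R]_n) : sqnorm (- v) = sqnorm v.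
Proof. by rewrite /sqnorm linearN/= mulNmx mulmxN opprK. Qed.

Lemma sqnormZ n (c : R) (v : 'rV[R]_n) : sqnorm (c *: v) = c ^+ 2 * sqnorm v.
Proof. by rewrite /sqnorm linearZ/= -scalemxAl -scalemxAr scalerA mxE expr2. Qed.

Lemma sqnorm_row_mx m n (u : 'rV[R]_m) (v : 'rV[R]_n) :
  sqnorm (row_mx u v) = sqnorm u + sqnorm v.
Proof. by rewrite /sqnorm tr_row_mx mul_row_col mxE. Qed.

Lemma sqnorm_mulmx m n (v : 'rV[R]_m) (M : 'M[R]_(m, n)) :
  M *m M^T = 1%:M -> sqnorm (v *m M) = sqnorm v.
Proof. by move=> MM; rewrite /sqnorm trmx_mul mulmxA -(mulmxA v) MM mulmx1. Qed.

Lemma measurable_sqnorm d (T : measurableType d) n (F : T -> 'rV[R]_n) :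
  (forall i, measurable_fun setT (fun x => F x 0 i : mR R)) ->
  measurable_fun setT (fun x => sqnorm (F x) : mR R).
Proof.
move=> mF; under eq_fun do rewrite sqnormE.
apply: (@measurable_sum _ T R) => i.
by apply: measurable_funX; exact: mF.
Qed.

(** Since [normal_peak 1] is (2 pi)^(-1/2), this is the joint density of n independent standard
    normal variables. *)
Definition gauss_pdf n (t : n.-tuple (mR R)) : R :=
  normal_peak 1 ^+ n * expR (- sqnorm (row_of_tuple t) / 2).

Lemma gauss_pdf_ge0 n (t : n.-tuple (mR R)) : 0 <= gauss_pdf t.
Proof. by rewrite mulr_ge0 ?exprn_ge0 ?normal_peak_ge0 ?expR_ge0. Qed.

Lemma gauss_pdf_cat m n (s : m.-tuple (mR R)) (t : n.-tuple (mR R)) :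
  gauss_pdf [tuple of s ++ t] = gauss_pdf s * gauss_pdf t.
Proof.
rewrite /gauss_pdf row_of_tuple_cat sqnorm_row_mx opprD mulrDl expRD exprD.
by rewrite mulrACA.
Qed.

Lemma gauss_pdf_cons n (x : mR R) (t : n.-tuple (mR R)) :
  gauss_pdf (cons_pair (x, t)) = normal_pdf 0 1 x * gauss_pdf t.
Proof.
rewrite normal_pdfE ?oner_neq0// /gauss_pdf row_of_tuple_cons.
rewrite [sqnorm _](@sqnorm_row_mx 1 n) opprD mulrDl expRD exprS mulrACA.
congr (_ * expR _ * _); rewrite sqnormE big_ord1 !mxE eqxx mulr1n subr0.
by rewrite expr1n.
Qed.

Lemma gauss_pdf_mulmx n (t : n.-tuple (mR R)) (M : 'M[R]_n) :
  M *m M^T = 1%:M ->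
  gauss_pdf (tuple_of_row (row_of_tuple t *m M)) = gauss_pdf t.
Proof. by move=> MM; rewrite /gauss_pdf tuple_of_rowK sqnorm_mulmx. Qed.

Lemma measurable_gauss_pdf n : measurable_fun setT (@gauss_pdf n).
Proof.
apply: measurable_funM; first exact: measurable_cst.
apply: (measurableT_comp (@measurable_expR R)).
apply: measurable_funM; last exact: measurable_cst.
apply: measurableT_comp => //; apply: measurable_sqnorm => i.
exact: measurable_row_coord.
Qed.

Lemma measurable_EFin_gauss_pdf n :
  measurable_fun setT (fun t => (@gauss_pdf n t)%:E).
Proof. by apply/measurable_EFinP; exact: measurable_gauss_pdf. Qed.

Local Open Scope ereal_scope.

Lemma integral_gauss_pdf n : \int[leb n]_t (gauss_pdf t)%:E = 1.
Proof.
elim: n => [|n IH].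
  rewrite ge0_integral_leb0; last by move=> t; rewrite lee_fin gauss_pdf_ge0.
  rewrite /gauss_pdf expr0 sqnormE big_ord0 oppr0 mul0r expR0 mulr1//.
rewrite ge0_integral_lebS; last 2 first.
- exact: measurable_EFin_gauss_pdf.
- by move=> t; rewrite lee_fin gauss_pdf_ge0.
rewrite -[RHS](@integral_normal_pdf R 0%R 1%R).
apply: eq_integral => x _.
under eq_integral do rewrite gauss_pdf_cons EFinM.
rewrite ge0_integralZl//; last 3 first.
- exact: measurable_EFin_gauss_pdf.
- by move=> t _; rewrite lee_fin gauss_pdf_ge0.
- by rewrite lee_fin normal_pdf_ge0.
by rewrite IH mule1.
Qed.

Definition gauss_expectation n (f : n.-tuple (mR R) -> \bar R) : \bar R :=
  \int[leb n]_t (f t * (gauss_pdf t)%:E).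

Lemma gauss_expectation_ge0 n (f : n.-tuple (mR R) -> \bar R) :
  (forall t, 0 <= f t) -> 0 <= gauss_expectation f.
Proof.
move=> f0; apply: integral_ge0 => t _.
by rewrite mule_ge0// lee_fin gauss_pdf_ge0.
Qed.

Lemma gauss_expectation_cst n (c : \bar R) : 0 <= c ->
  gauss_expectation (fun _ : n.-tuple (mR R) => c) = c.
Proof.
move=> c0; rewrite /gauss_expectation ge0_integralZl//.
- by rewrite integral_gauss_pdf mule1.
- exact: measurable_EFin_gauss_pdf.
- by move=> t _; rewrite lee_fin gauss_pdf_ge0.
Qed.

Lemma le_gauss_expectation n (f g : n.-tuple (mR R) -> \bar R) :
  measurable_fun setT f -> measurable_fun setT g ->
  (forall t, 0 <= f t) -> (forall t, f t <= g t) ->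
  gauss_expectation f <= gauss_expectation g.
Proof.
move=> mf mg f0 fg; apply: ge0_le_integral => //.
- by move=> t _; rewrite mule_ge0// lee_fin gauss_pdf_ge0.
- by apply: emeasurable_funM => //; exact: measurable_EFin_gauss_pdf.
- by apply: emeasurable_funM => //; exact: measurable_EFin_gauss_pdf.
- by move=> t _; rewrite lee_wpmul2r// lee_fin gauss_pdf_ge0.
Qed.

Lemma measurable_gauss_expectation d (T : measurableType d) n
    (f : T -> n.-tuple (mR R) -> \bar R) :
  measurable_fun setT (fun p => f p.1 p.2) -> (forall x y, 0 <= f x y) ->
  measurable_fun setT (fun x => gauss_expectation (f x)).
Proof.
move=> mf f0; apply: measurable_parametric_integral.
  apply: emeasurable_funM => //.
  by apply: (measurableT_comp (@measurable_EFin_gauss_pdf n)).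
by move=> x y; rewrite mule_ge0// lee_fin gauss_pdf_ge0.
Qed.

Lemma gauss_expectation_cat m n (f : (m + n).-tuple (mR R) -> \bar R) :
  measurable_fun setT f -> (forall t, 0 <= f t) ->
  gauss_expectation f =
  gauss_expectation (fun s : m.-tuple (mR R) =>
    gauss_expectation (fun t : n.-tuple (mR R) => f [tuple of s ++ t])).
Proof.
move=> mf f0; rewrite /gauss_expectation ge0_integral_leb_cat; last 2 first.
- by apply: emeasurable_funM => //; exact: measurable_EFin_gauss_pdf.
- by move=> t; rewrite mule_ge0// lee_fin gauss_pdf_ge0.
apply: eq_integral => s _; rewrite -ge0_integralZr//; last 3 first.
- apply: emeasurable_funM; last exact: measurable_EFin_gauss_pdf.
  exact: measurable_fun_cat.
- by move=> t _; rewrite mule_ge0// lee_fin gauss_pdf_ge0.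
- by rewrite lee_fin gauss_pdf_ge0.
by apply: eq_integral => t _; rewrite gauss_pdf_cat EFinM -muleA (muleC (gauss_pdf s)%:E).
Qed.

Lemma measurable_mulmx_tuple d (T : measurableType d) m n
    (F : T -> m.-tuple (mR R)) (M : 'M[R]_(m, n)) :
  measurable_fun setT F ->
  measurable_fun setT (fun x => tuple_of_row (row_of_tuple (F x) *m M)).
Proof.
move=> mF; apply: measurable_tuple_of_row => i; apply: measurable_row_mulmx => j.
by apply: (measurableT_comp (@measurable_row_coord R m j)).
Qed.

(* Uniqueness of Haar measure in disguise: integrate f(xM) phi(y - xM), with phi
   a rotation-invariant probability density, in both orders. *)
Lemma ge0_integral_leb_orthogonal n (M : 'M[R]_n) (f : n.-tuple (mR R) -> \bar R) :
  M *m M^T = 1%:M -> measurable_fun setT f -> (forall t, 0 <= f t) ->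
  \int[leb n]_t f (tuple_of_row (row_of_tuple t *m M)) = \int[leb n]_t f t.
Proof.
move=> MM mf f0.
have phi0 (t : n.-tuple (mR R)) : 0 <= (gauss_pdf t)%:E.
  by rewrite lee_fin gauss_pdf_ge0.
have mphi := @measurable_EFin_gauss_pdf n.
pose T t := tuple_of_row (row_of_tuple t *m M).
have mT : measurable_fun setT T by exact: measurable_mulmx_tuple.
have mfT : measurable_fun setT (fun t => f (T t)) by exact: measurableT_comp.
pose add (b : R) (p : n.-tuple (mR R) * n.-tuple (mR R)) :=
  tuple_of_row (1 *: row_of_tuple p.2 + b *: (row_of_tuple p.1 *m M))%R.
have madd b : measurable_fun setT (add b).
  apply: measurable_tuple_of_row => i.
  rewrite (_ : (fun _ => _) = (fun p : n.-tuple (mR R) * n.-tuple (mR R) =>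
      row_of_tuple p.2 0 i + b * (row_of_tuple p.1 *m M) 0 i)%R); last first.
    by apply/funext => p; rewrite scale1r [LHS]mxE; congr (_ + _)%R; rewrite mxE.
  apply: measurable_funD.
    by apply: (measurableT_comp (@measurable_row_coord R n i)).
  apply: measurable_funM; first exact: measurable_cst.
  apply: measurable_row_mulmx => j.
  by apply: (measurableT_comp (@measurable_row_coord R n j)).
have shift b g x : measurable_fun setT g -> (forall t, 0 <= g t) ->
    \int[leb n]_y g y = \int[leb n]_y g (add b (x, y)).
  move=> mg g0; rewrite
    (@ge0_integral_leb_affine R n 1 (b *: (row_of_tuple x *m M))%R _ ltr01 mg g0).
  by rewrite expr1n mul1e.
have -> : \int[leb n]_t f (T t) =
    \int[leb n]_x \int[leb n]_y (f (T x) * (gauss_pdf (add (-1)%R (x, y)))%:E).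
  apply: eq_integral => x _; rewrite ge0_integralZl//; last first.
    apply: (measurableT_comp mphi).
    exact: (measurableT_comp (madd _) (pair1_measurable x)).
  by rewrite -(shift _ (EFin \o @gauss_pdf n))//= integral_gauss_pdf mule1.
rewrite (@fubini_tonelli _ _ _ _ R (leb n) (leb n)
  (fun p => f (T p.1) * (gauss_pdf (add (-1)%R p))%:E)); last 2 first.
- apply: emeasurable_funM; first exact: (measurableT_comp mfT measurable_fst).
  exact: (measurableT_comp mphi (madd _)).
- by move=> p; exact: mule_ge0.
have -> : \int[leb n]_y \int[leb n]_x
      (f (T x) * (gauss_pdf (add (-1)%R (x, y)))%:E) =
    \int[leb n]_y \int[leb n]_x (f (add 1%R (x, y)) * (gauss_pdf x)%:E).
  apply: eq_integral => y _.
  (* Translating x by y M^T turns x M into x M + y and y - x M into - x M; the density at - x M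
     equals the density at x because it is even and rotation invariant. *)
  rewrite (@ge0_integral_leb_affine R n 1 (row_of_tuple y *m M^T) _ ltr01); last 2 first.
  - apply: emeasurable_funM => //; apply: (measurableT_comp mphi).
    exact: (measurableT_comp (madd _) (pair2_measurable y)).
  - by move=> x; exact: mule_ge0.
  rewrite expr1n mul1e; apply: eq_integral => x _.
  have MM' : (M^T *m M = 1%:M)%R by exact: mulmx1C.
  congr (f _ * _).
    rewrite /T /add/= tuple_of_rowK !scale1r mulmxDl -mulmxA MM' mulmx1.
    by rewrite addrC.
  rewrite /add/= /gauss_pdf !tuple_of_rowK !scale1r mulmxDl -mulmxA MM' mulmx1.
  by rewrite scaleN1r opprD addrCA subrr addr0 sqnormN sqnorm_mulmx.
rewrite -(@fubini_tonelli _ _ _ _ R (leb n) (leb n)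
  (fun p => f (add 1%R p) * (gauss_pdf p.1)%:E)); last 2 first.
- apply: emeasurable_funM; first exact: (measurableT_comp mf (madd _)).
  exact: (measurableT_comp mphi measurable_fst).
- by move=> p; exact: mule_ge0.
rewrite -[RHS](@gauss_expectation_cst n); last exact: integral_ge0.
apply: eq_integral => x _.
transitivity (\int[leb n]_y (f (add 1%R (x, y)) * (gauss_pdf x)%:E)) => //.
rewrite ge0_integralZr//; last first.
  apply: measurableT_comp => //.
  exact: (measurableT_comp (madd _) (pair1_measurable x)).
by rewrite -(shift _ f).
Qed.

Lemma gauss_expectation_orthogonal n (M : 'M[R]_n) (f : n.-tuple (mR R) -> \bar R) :
  M *m M^T = 1%:M -> measurable_fun setT f -> (forall t, 0 <= f t) ->
  gauss_expectation (fun t => f (tuple_of_row (row_of_tuple t *m M))) =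
  gauss_expectation f.
Proof.
move=> MM mf f0; rewrite /gauss_expectation.
under eq_integral => t _ do rewrite -(gauss_pdf_mulmx t MM).
apply: (@ge0_integral_leb_orthogonal _ _ (fun t => f t * (gauss_pdf t)%:E)) => //.
  by apply: emeasurable_funM => //; exact: measurable_EFin_gauss_pdf.
by move=> t; rewrite mule_ge0// lee_fin gauss_pdf_ge0.
Qed.

End gaussian_density.

(** * Orthonormal completion and Gaussian marginals *)

Section orthonormal_completion.
Context {R : realType}.

(** Gram-Schmidt one row at a time: as long as [K] stacked on [G] has fewer than N rows, some
    nonzero vector is orthogonal to all of them. The count uses the number of rows of [K] and not
    its rank, so singular [K] is covered. *)
Lemma exists_orthonormal_rows m r N (K : 'M[R]_(m, N)) : (m + r <= N)%N ->
  exists G : 'M[R]_(r, N), G *m G^T = 1%:M /\ K *m G^T = 0.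
Proof.
elim: r => [_|r IH].
  by exists 0; split; apply/matrixP => i j; [case: i|case: j].
rewrite addnS => mrN; have [G [GG KG]] := IH (ltnW mrN).
pose B := col_mx K G.
have : kermx B^T != 0.
  rewrite -mxrank_eq0 mxrank_ker -lt0n subn_gt0 mxrank_tr.
  exact: leq_ltn_trans (rank_leq_row B) mrN.
case/rowV0Pn => v /sub_kermxP; rewrite tr_col_mx mul_mx_row.
rewrite -[RHS]row_mx0 => /eq_row_mx[vK vG] v0.
have s0 : 0 < sqnorm v by rewrite lt_def sqnorm_eq0 v0 sqnorm_ge0.
pose u := (Num.sqrt (sqnorm v))^-1 *: v.
have uu : u *m u^T = 1%:M.
  rewrite [LHS]mx11_scalar -/(sqnorm u) sqnormZ exprVn sqr_sqrtr ?sqnorm_ge0//.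
  by rewrite mulVf// gt_eqF.
have uG : u *m G^T = 0 by rewrite -scalemxAl vG scaler0.
rewrite -[r.+1]/(1 + r)%N; exists (col_mx u G); split.
  rewrite tr_col_mx mul_col_row uu uG GG.
  by rewrite -[G *m u^T]trmxK trmx_mul trmxK uG trmx0 -scalar_mx_block.
rewrite tr_col_mx mul_mx_row KG -[K *m _]trmxK trmx_mul trmxK -scalemxAl vK.
by rewrite scaler0 trmx0 row_mx0.
Qed.

(** Completing [Q] to a square orthogonal matrix makes t Q the first n coordinates of a rotated
    Gaussian vector; the other N - n coordinates integrate out to 1. *)
Lemma gauss_expectation_orthonormal N n (Q : 'M[R]_(N, n))
    (f : n.-tuple (mR R) -> \bar R) : Q^T *m Q = 1%:M ->
  measurable_fun setT f -> (forall t, 0 <= f t)%E ->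
  gauss_expectation (fun t => f (tuple_of_row (row_of_tuple t *m Q))) =
  gauss_expectation f.
Proof.
move=> QQ mf f0; have /subnKC nN := mulmx1_min QQ.
(* Replaces N by [n + k] in the types, so that the completed matrix is square without a cast. *)
move: (N - n)%N nN => k nN; case: _ / nN in Q QQ *.
have [|G [GG QG]] := @exists_orthonormal_rows _ k _ Q^T; first exact: leqnn.
pose M := row_mx Q G^T.
have MM : M *m M^T = 1%:M.
  apply: mulmx1C; rewrite tr_row_mx mul_col_row trmxK QQ QG GG.
  by rewrite -[G *m Q]trmxK trmx_mul QG trmx0 -scalar_mx_block.
pose g (t : (n + k).-tuple (mR R)) : \bar R :=
  f (tuple_of_row (lsubmx (row_of_tuple t))).
have mg : measurable_fun setT g.
  apply: measurableT_comp => //; apply: measurable_tuple_of_row => i.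
  by under eq_fun do rewrite mxE; exact: measurable_row_coord.
transitivity (gauss_expectation g).
  rewrite -(gauss_expectation_orthogonal MM mg) => [|t]; last exact: f0.
  apply: eq_integral => t _; rewrite /g tuple_of_rowK mul_mx_row row_mxKl//.
rewrite gauss_expectation_cat// => [|t]; last exact: f0.
apply: eq_integral => s _; congr (_ * _)%E.
rewrite -[RHS](@gauss_expectation_cst R k) ?f0//.
by apply: eq_integral => t _; rewrite /g row_of_tuple_cat row_mxKl row_of_tupleK.
Qed.

End orthonormal_completion.

(** * The Gaussian measure on tuples and its characterization by boxes *)

Section gaussian_vector.
Context {R : realType}.
Local Notation leb := (@lebesgue_measure_tuple R).
Local Open Scope ereal_scope.

Definition gauss_prob n (B : set (n.-tuple (mR R))) : \bar R :=
  \int[leb n]_(t in B) (gauss_pdf t)%:E.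

Section instance.
Variable n : nat.

Let gauss_prob0 : @gauss_prob n set0 = 0.
Proof. by rewrite /gauss_prob integral_set0. Qed.

Let gauss_prob_ge0 B : 0 <= @gauss_prob n B.
Proof. by apply: integral_ge0 => t _; rewrite lee_fin gauss_pdf_ge0. Qed.

Let gauss_prob_sigma_additive : semi_sigma_additive (@gauss_prob n).
Proof.
move=> F mF tF mUF; rewrite /gauss_prob ge0_integral_bigcup//; last 2 first.
- exact: measurable_funTS (@measurable_EFin_gauss_pdf R n).
- by move=> t _; rewrite lee_fin gauss_pdf_ge0.
apply: is_cvg_ereal_nneg_natsum_cond => m _ _; exact: gauss_prob_ge0.
Qed.

HB.instance Definition _ := isMeasure.Build _ _ _ (@gauss_prob n)
  gauss_prob0 gauss_prob_ge0 gauss_prob_sigma_additive.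

End instance.

Lemma gauss_probE n (B : set (n.-tuple (mR R))) : measurable B ->
  gauss_prob B = gauss_expectation (fun t => (\1_B t)%:E).
Proof.
move=> mB; rewrite /gauss_prob integral_mkcond; apply: eq_integral => t _.
by rewrite patchE indicE; case: ifPn => _; rewrite ?mul1e ?mul0e.
Qed.

Lemma gauss_expectation_box n (B : 'I_n -> set (mR R)) :
  (forall i, measurable (B i)) ->
  gauss_expectation (fun t => (\prod_i \1_(B i) (tnth t i))%R%:E) =
  \prod_i normal_prob 0 1 (B i).
Proof.
elim: n B => [|n IH] B mB.
  rewrite /gauss_expectation big_ord0.
  under eq_integral do rewrite big_ord0 mul1e.
  exact: integral_gauss_pdf.
have mprod k (C : 'I_k -> set (mR R)) : (forall i, measurable (C i)) ->
    measurable_fun setT (fun t : k.-tuple (mR R) =>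
      (\prod_i \1_(C i) (tnth t i))%R%:E : \bar R).
  move=> mC; apply/measurable_EFinP; apply: (@measurable_prod _ _ R) => i _.
  by apply: measurableT_comp; [exact: measurable_indic|exact: measurable_tnth].
have prod0 k (C : 'I_k -> set (mR R)) (t : k.-tuple (mR R)) :
    0 <= (\prod_i \1_(C i) (tnth t i))%R%:E :> \bar R.
  by rewrite lee_fin; apply: prodr_ge0 => i _; rewrite indicE.
rewrite /gauss_expectation ge0_integral_lebS; last 2 first.
- by apply: emeasurable_funM; [exact: mprod|exact: measurable_EFin_gauss_pdf].
- by move=> t; rewrite mule_ge0// lee_fin gauss_pdf_ge0.
rewrite big_ord_recl -IH; last by move=> i; exact: mB.
set E := gauss_expectation _.
have E0 : 0 <= E by exact: gauss_expectation_ge0.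
rewrite /normal_prob -ge0_integralZr//; last 2 first.
- by apply/measurable_EFinP/measurable_funTS; exact: measurable_normal_pdf.
- by move=> x _; rewrite lee_fin normal_pdf_ge0.
rewrite [RHS]integral_mkcond; apply: eq_integral => x _.
transitivity (\int[leb n]_t ((\1_(B ord0) x * normal_pdf 0 1 x)%R%:E *
    ((\prod_i \1_(B (lift ord0 i)) (tnth t i))%R%:E * (gauss_pdf t)%:E))).
  apply: eq_integral => t _; rewrite gauss_pdf_cons big_ord_recl.
  under [in LHS]eq_bigr do rewrite tnthS.
  by rewrite -!EFinM mulrACA.
rewrite ge0_integralZl//; last 3 first.
- apply: emeasurable_funM; last exact: measurable_EFin_gauss_pdf.
  by apply: mprod.
- by move=> t _; rewrite mule_ge0// lee_fin gauss_pdf_ge0.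
- by rewrite lee_fin mulr_ge0// ?normal_pdf_ge0// indicE.
by rewrite patchE indicE; case: ifPn => _; rewrite ?mul1r// mul0r mul0e.
Qed.

End gaussian_vector.

Section gaussian_law.
Context {R : realType}.
Local Open Scope ereal_scope.

Definition box n (B : 'I_n -> set (mR R)) : set (n.-tuple (mR R)) :=
  [set t | forall i, B i (tnth t i)].

Lemma measurable_box n (B : 'I_n -> set (mR R)) :
  (forall i, measurable (B i)) -> measurable (box B).
Proof.
move=> mB; rewrite (_ : box B = \bigcap_(i in [set: 'I_n])
    ((fun t : n.-tuple (mR R) => tnth t i) @^-1` B i)).
  apply: fin_bigcap_measurable => // i _.
  by rewrite -[X in measurable X]setTI; exact: measurable_tnth.
by apply/seteqP; split => t /= h i => [_|]; exact: h.
Qed.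

Lemma indic_box n (B : 'I_n -> set (mR R)) t :
  \1_(box B) t = (\prod_i \1_(B i) (tnth t i))%R :> R.
Proof.
rewrite indicE; case: (pselect (box B t)) => [tB|ntB].
  by rewrite mem_set// big1// => i _; rewrite indicE mem_set.
have /existsNP[i nBi] : ~ forall i, B i (tnth t i) by exact: ntB.
by rewrite memNset// (bigD1 i)//= indicE memNset// mul0r.
Qed.

Lemma gauss_prob_box n (B : 'I_n -> set (mR R)) :
  (forall i, measurable (B i)) -> gauss_prob (box B) = \prod_i normal_prob 0 1 (B i).
Proof.
move=> mB; rewrite gauss_probE; last exact: measurable_box.
rewrite -gauss_expectation_box//; apply: eq_integral => t _.
by rewrite indic_box.
Qed.

(** The defining generators constrain one coordinate at a time and are in general not closed under
    intersection; boxes are, as the uniqueness theorem for measures requires. *)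
Lemma measurable_tuple_boxE n : @measurable _ (n.-tuple (mR R)) =
  <<s [set box B | B in [set B | forall i, measurable (B i)]] >>.
Proof.
apply/seteqP; split; last first.
  apply: smallest_sub; first exact: sigma_algebra_measurable.
  by move=> _ [B mB <-]; exact: measurable_box.
apply: smallest_sub; first exact: smallest_sigma_algebra.
rewrite -bigcup_seq => A [i _ [C mC <-]]; rewrite setTI.
apply: sub_sigma_algebra.
exists (fun j => if j == i then C else setT) => [j /=|].
  by case: ifP => // _; exact: measurableT.
apply/seteqP; split => t /=; first by move=> /(_ i); rewrite eqxx.
by move=> Ct j; case: eqP => // ->.
Qed.

Lemma tuple_prob_unique n (mu : {measure set (n.-tuple (mR R)) -> \bar R}) :
  (forall B : 'I_n -> set (mR R), (forall i, measurable (B i)) ->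
    mu (box B) = \prod_i normal_prob 0 1 (B i)) ->
  forall A, measurable A -> mu A = gauss_prob A.
Proof.
move=> muE A mA; symmetry.
apply: (measure_unique
  [set box B | B in [set B | forall i, measurable (B i)]] (fun=> setT)
  (measurable_tuple_boxE n)) => //.
- move=> _ _ [B mB <-] [C mC <-].
  exists (fun i => B i `&` C i) => [i /=|]; first exact: measurableI.
  apply/seteqP; split => t /=; first by move=> h; split => i; have [] := h i.
  by move=> [hB hC] i.
- move=> _; exists (fun=> setT) => //.
  by apply/seteqP; split.
- by rewrite bigcup_const.
- by move=> _ [B mB <-]; rewrite muE//; exact: gauss_prob_box.
- by move=> _; rewrite [X in X < _]integral_gauss_pdf ltry.
Qed.

(** On a box, independence over the whole index set and the normal marginals give the product that
    characterizes [gauss_prob]. *)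
Lemma gaussian_family_law d (O : measurableType d) (P : probability O R)
    (I : finType) n (e : 'I_n -> I) (X : I -> {RV P >-> mR R}) :
  bijective e -> mutually_independent X ->
  (forall i B, measurable B -> distribution P (X i) B = normal_prob 0 1 B) ->
  forall A, measurable A ->
    P [set om | A [tuple (X (e i) om : mR R) | i < n]] = gauss_prob A.
Proof.
move=> [e' eK e'K] indX XE A mA.
pose F om : n.-tuple (mR R) := [tuple (X (e i) om : mR R) | i < n].
have mF : measurable_fun setT F.
  apply/measurable_fun_tnthP => i.
  rewrite (_ : _ \o _ = X (e i)); first exact: measurable_funP.
  by apply/funext => om /=; rewrite tnth_mktuple.
pose mu_ : {measure set (n.-tuple (mR R)) -> \bar R} := pushforward P F.
apply: (@tuple_prob_unique n (mu_ mF)) => // B mB.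
transitivity (P (\bigcap_(i in [set` [set: I]%SET]) (X i @^-1` B (e' i)))).
  congr (P _); apply/seteqP; split => om /=.
    by move=> h i _; have := h (e' i); rewrite tnth_mktuple e'K.
  by move=> h i; rewrite tnth_mktuple; have := h (e i); rewrite /= eK; apply; rewrite inE.
rewrite (indX [set: I]%SET (fun i => B (e' i)))//.
rewrite (reindex e); last by exists e' => ? _.
apply: eq_big => [i|i _]; first by rewrite inE.
by rewrite eK; exact: XE.
Qed.

End gaussian_law.

(** * Measurability deduced from continuity *)

Section continuity_in_coordinates.
Context {R : realType}.

Lemma filter_finite_forall T (F : set_system T) (I : finType) (P : I -> set T) :
  Filter F -> (forall i, F (P i)) -> F [set z | forall i, P i z].
Proof.
move=> FF FP.
suff : F [set z | forall i, i \in enum I -> P i z].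
  by apply: filterS => z h i; apply: h; rewrite mem_enum.
elim: (enum I) => [|i s IH]; first exact: filterS filterT.
apply: filterS (filterI (FP i) IH) => z [iz sz] j.
by rewrite inE => /predU1P[->|/sz].
Qed.

Lemma continuous_mx_coord (X : topologicalType) m n (h : X -> 'M[R]_(m, n)) :
  (forall i j, continuous (fun x => h x i j)) -> continuous h.
Proof.
move=> hc x P /nbhs_ballP[e /= e0 eP].
have : nbhs x [set z | forall ij : 'I_m * 'I_n,
    ball (h x ij.1 ij.2) e (h z ij.1 ij.2)].
  apply: filter_finite_forall => -[i j]; apply: (hc i j x).
  exact: nbhsx_ballx.
by apply: filterS => z hz; apply: eP; split => // i j; exact: (hz (i, j)).
Qed.

Lemma continuous_mxP m n (f : 'M[R]_(m, n) -> R) (x : 'M[R]_(m, n)) (e : R) :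
  continuous f -> 0 < e -> exists2 r, 0 < r &
  forall z : 'M[R]_(m, n), (forall i j, `|x i j - z i j| < r) -> `|f x - f z| < e.
Proof.
move=> fc e0.
have /nbhs_ballP[r /= r0 rP] : nbhs x (f @^-1` ball (f x) e).
  by apply: fc; exact: nbhsx_ballx.
by exists r => // z xz; apply: rP; split => // i j; exact: xz.
Qed.

Lemma rat_approx m n (x : 'M[R]_(m, n)) (e : R) : 0 < e ->
  exists q : 'M[rat]_(m, n), forall i j, `|x i j - ratr (q i j)| < e.
Proof.
move=> e0.
have /choice[q qP] (ij : 'I_m * 'I_n) :
    exists q : rat, `|x ij.1 ij.2 - ratr q| < e.
  have /rat_in_itvoo[q] : x ij.1 ij.2 - e < x ij.1 ij.2 + e by lra.
  rewrite in_itv/= => /andP[q1 q2]; exists q.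
  by rewrite ltr_distlC q1 q2.
exists (\matrix_(i, j) q (i, j)) => i j.
by rewrite mxE; exact: (qP (i, j)).
Qed.

(** The set where [f] exceeds a is open, hence a countable union of sup-norm balls with rational
    centre and radius 1/(k+1). [D] selects the balls inside this set, and [B] is the preimage of a
    ball, a finite intersection of coordinate conditions. *)
Lemma measurable_continuous_mx d (T : measurableType d) m n
    (f : 'M[R]_(m, n) -> R) (phi : T -> 'M[R]_(m, n)) :
  continuous f -> (forall i j, measurable_fun setT (fun t => phi t i j : mR R)) ->
  measurable_fun setT (fun t => f (phi t) : mR R).
Proof.
move=> fc mphi mD; apply: (measurability _ (RGenOInfty.measurableE R)) => //.
move=> /= _ [_ [a ->] <-]; rewrite preimage_itvoy setTI.
pose D : set ('M[rat]_(m, n) * nat) :=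
  [set qk : 'M[rat]_(m, n) * nat | forall x : 'M[R]_(m, n),
  (forall i j, `|x i j - ratr (qk.1 i j)| < qk.2.+1%:R^-1) -> a < f x].
pose B (qk : 'M[rat]_(m, n) * nat) := [set t | forall ij : 'I_m * 'I_n,
  `|phi t ij.1 ij.2 - ratr (qk.1 ij.1 ij.2)| < qk.2.+1%:R^-1].
rewrite (_ : [set t | _] = \bigcup_qk (if `[< D qk >] then B qk else set0)); last first.
  apply/seteqP; split => t /=.
    rewrite -subr_gt0 => af.
    have [r r0 rP] := @continuous_mxP _ _ f (phi t) _ fc af.
    (* Half of r, because two points of the rational ball are compared through its centre. *)
    have [k kr] : exists k, k.+1%:R^-1 < r / 2.
      by exists (Num.truncn (r / 2)^-1); rewrite invf_plt ?posrE ?divr_gt0// truncnS_gt.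
    have [q qP] := @rat_approx _ _ (phi t) k.+1%:R^-1 ltac:(by rewrite invr_gt0).
    exists (q, k) => //; case: asboolP => [_ ij|nD]; first exact: qP.
    exfalso; apply: nD => x xq.
    suff : `|f (phi t) - f x| < f (phi t) - a.
      by move=> /(le_lt_trans (ler_norm _)); lra.
    apply: rP => i j; apply: (@le_lt_trans _ _
      (`|phi t i j - ratr (q i j)| + `|x i j - ratr (q i j)|)).
      by rewrite (distrC (x i j)) ler_distD.
    by rewrite [r in _ < r]splitr ltrD// (lt_trans _ kr)//; exact: xq.
  by move=> [qk _]; case: asboolP => // Dq Bq; apply: Dq => i j; exact: (Bq (i, j)).
apply: countable_bigcupT_measurable => [|qk]; first exact: countableP.
case: asboolP => // _.
rewrite (_ : B qk = \bigcap_(ij in [set: 'I_m * 'I_n]) ((fun t => phi t ij.1 ij.2) @^-1`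
   [set` `]ratr (qk.1 ij.1 ij.2) - qk.2.+1%:R^-1,
     ratr (qk.1 ij.1 ij.2) + qk.2.+1%:R^-1[])).
  apply: fin_bigcap_measurable => // ij _; rewrite -[X in measurable X]setTI.
  by apply: mphi => //; exact: measurable_itv.
by apply/seteqP; split => t h ij => [_|]; have := h ij;
  rewrite /= in_itv/= -ltr_distlC distrC => //; exact.
Qed.

(** A projection of a measurable set is made countable: a zero exists iff, in some cube [K k],
    rational points bring [g t] below every 1/(j+1). Conversely the minimum over the compact cube is
    attained and, being below each of these bounds, is 0. *)
Lemma measurable_exists_zero d (T : measurableType d) n (g : T -> 'rV[R]_n -> R) :
  (forall t, continuous (g t)) ->
  (forall y, measurable_fun setT (fun t => g t y : mR R)) ->
  (forall t y, 0 <= g t y) -> measurable [set t | exists y, g t y = 0].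
Proof.
move=> gc gm g0.
pose K (k : nat) : set 'rV[R]_n := [set y | forall i, `[- k%:R, k%:R]%classic (y ord0 i)].
have cK k : compact (K k).
  have := @rV_compact R n (fun=> `[- k%:R, k%:R]%classic).
  by apply => i; exact: segment_compact.
pose B (k j : nat) (q : 'rV[rat]_n) : set T := if `[< K k (map_mx ratr q) >] then
  [set t | g t (map_mx ratr q) < j.+1%:R^-1] else set0.
rewrite (_ : [set t | _] = \bigcup_k \bigcap_j \bigcup_q B k j q).
  apply: bigcupT_measurable => k; apply: bigcapT_measurable => j.
  apply: countable_bigcupT_measurable => [|q]; first exact: countableP.
  rewrite /B; case: asboolP => // _.
  rewrite (_ : [set t | _] = (fun t => g t (map_mx ratr q) : mR R) @^-1`
    [set` `]-oo, j.+1%:R^-1[]).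
    by rewrite -[X in measurable X]setTI; apply: gm => //; exact: measurable_itv.
  by apply/seteqP; split => t /=; rewrite in_itv.
apply/seteqP; split => t /=.
  move=> [y gy].
  (* The additional unit leaves a margin of 1 around y, so that a rational point closer than 1 stays
     in [K k]. *)
  pose k := (Num.truncn (\sum_i `|y 0 i|)).+2.
  have yk i : `|y 0 i| < k%:R - 1.
    have yS : `|y 0 i| <= \sum_i `|y 0 i| by rewrite (bigD1 i)//= lerDl sumr_ge0.
    by rewrite /k -[_.+2%:R]natr1 addrK (le_lt_trans yS)// truncnS_gt.
  exists k => // j _.
  have j0 : (0 : R) < j.+1%:R^-1 by rewrite invr_gt0.
  have [r r0 rP] := @continuous_mxP _ _ (g t) y _ (gc t) j0.
  have [q qP] := @rat_approx _ _ y (Num.min r 1) ltac:(by rewrite lt_min r0/=).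
  exists q => //; rewrite /B; case: asboolP => [_|nK] /=.
    have : `|g t y - g t (map_mx ratr q)| < j.+1%:R^-1.
      by apply: rP => i l; have := qP i l; rewrite lt_min mxE => /andP[].
    by rewrite gy sub0r normrN ger0_norm.
  exfalso; apply: nK => i /=; rewrite in_itv/= mxE.
  have := qP ord0 i; rewrite lt_min => /andP[_]; rewrite ltr_norml => /andP[h1 h2].
  have := yk i; rewrite ltr_norml => /andP[h3 h4].
  by apply/andP; split; lra.
move=> [k _ h].
have [q0 _ Bq0] := h 0%N I.
have K0 : K k !=set0.
  by move: Bq0; rewrite /B; case: asboolP => // Kq _; exists (map_mx ratr q0).
have [y yK ymin] := EVT_min_rV K0 (cK k) (continuous_subspaceT (gc t)).
exists y; apply/eqP; rewrite eq_le g0 andbT; apply/ler_addgt0Pl => e e0; rewrite addr0.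
have [j je] : exists j, j.+1%:R^-1 < e.
  by exists (Num.truncn e^-1); rewrite invf_plt ?posrE// truncnS_gt.
have [q _] := h j I; rewrite /B; case: asboolP => // Kq /= gq.
apply: le_trans (ymin _ (mem_set Kq)) _.
by apply: ltW; exact: lt_trans gq je.
Qed.

End continuity_in_coordinates.

(** * Scale mixtures of Gaussian vectors *)

Section student_mixture.
Context {R : realType}.
Local Notation leb := (@lebesgue_measure_tuple R).

Lemma measurable_sqrtr : measurable_fun [set: mR R] (@Num.sqrt R : mR R -> mR R).
Proof. by apply: continuous_measurable_fun; exact: sqrt_continuous. Qed.

Definition tnorm n (t : n.-tuple (mR R)) : R := Num.sqrt (sqnorm (row_of_tuple t)).

Lemma tnorm_ge0 n (t : n.-tuple (mR R)) : 0 <= tnorm t.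
Proof. exact: sqrtr_ge0. Qed.

Lemma tnorm_scale n (c : R) (t : n.-tuple (mR R)) :
  0 <= c -> tnorm (tuple_of_row (c *: row_of_tuple t)) = c * tnorm t.
Proof.
move=> c0; rewrite /tnorm tuple_of_rowK sqnormZ sqrtrM ?sqr_ge0// sqrtr_sqr.
by rewrite ger0_norm.
Qed.

Lemma measurable_tnorm n : measurable_fun setT (@tnorm n).
Proof.
apply: (measurableT_comp measurable_sqrtr).
by apply: measurable_sqnorm => i; exact: measurable_row_coord.
Qed.

Lemma measurable_scale_tuple n (c : R) :
  measurable_fun setT (fun t : n.-tuple (mR R) => tuple_of_row (c *: row_of_tuple t)).
Proof.
apply: measurable_tuple_of_row => i; under eq_fun do rewrite !mxE.
by apply: measurable_funM; [exact: measurable_cst|exact: measurable_tnth].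
Qed.

Lemma gauss_pdf_scale n (c : R) (t : n.-tuple (mR R)) :
  gauss_pdf (tuple_of_row (c *: row_of_tuple t)) =
  normal_peak 1 ^+ n * expR (- (c ^+ 2 * sqnorm (row_of_tuple t)) / 2).
Proof. by rewrite /gauss_pdf tuple_of_rowK sqnormZ. Qed.

Local Open Scope ereal_scope.

Definition scaled_gauss l (r : R) (B : set (l.-tuple (mR R))) : \bar R :=
  gauss_expectation (fun c : l.-tuple (mR R) =>
    (\1_B (tuple_of_row (r *: row_of_tuple c)))%:E).

(** Conditional law given h of the Gaussian vector scaled by s / |h|. At h = 0, where the witness
    [y] is undefined, the value 0 makes the later lower bound trivial. *)
Definition student_kernel l n (s : R) (B : set (l.-tuple (mR R)))
    (h : n.-tuple (mR R)) : \bar R :=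
  if tnorm h == 0%R then 0 else scaled_gauss (s / tnorm h) B.

(* The density of the t-distribution up to its normalizing constant. *)
Definition student_pdf l (s : R) n (t : l.-tuple (mR R)) : R :=
  ((1 + sqnorm (row_of_tuple t) / s ^+ 2) `^ (- ((l%:R + n%:R) / 2)))%R.

(** The value at t = 0 of the mixture density; it plays the part of the normalizing constant. *)
Definition student_mass l n (s : R) : \bar R :=
  \int[leb n]_h ((tnorm h / s) ^+ l * normal_peak 1 ^+ l * gauss_pdf h)%:E.

Lemma scaled_gaussE l (r : R) (B : set (l.-tuple (mR R))) : (0 < r)%R ->
  measurable B ->
  scaled_gauss r^-1 B = \int[leb l]_t ((\1_B t)%:E *
    (r ^+ l * (normal_peak 1 ^+ l *
      expR (- (r ^+ 2 * sqnorm (row_of_tuple t)) / 2)))%:E).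
Proof.
move=> r0 mB; rewrite /scaled_gauss /gauss_expectation.
have mind : measurable_fun setT (fun t : l.-tuple (mR R) => (\1_B t)%:E : \bar R).
  by apply/measurable_EFinP; exact: measurable_indic.
have ind0 (t : l.-tuple (mR R)) : 0 <= (\1_B t)%:E :> \bar R by rewrite lee_fin indicE.
rewrite (@ge0_integral_leb_affine R l r 0 _ r0); last 2 first.
- apply: emeasurable_funM; last exact: measurable_EFin_gauss_pdf.
  exact: (measurableT_comp mind (measurable_scale_tuple _)).
- by move=> t; rewrite mule_ge0// lee_fin gauss_pdf_ge0.
rewrite -ge0_integralZl//; last 3 first.
- apply: emeasurable_funM.
    apply: (measurableT_comp mind).
    apply: (measurableT_comp (measurable_scale_tuple _)).
    by under eq_fun do rewrite addr0; exact: measurable_scale_tuple.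
  apply: (measurableT_comp (@measurable_EFin_gauss_pdf R l)).
  by under eq_fun do rewrite addr0; exact: measurable_scale_tuple.
- by move=> t _; rewrite mule_ge0// lee_fin gauss_pdf_ge0.
- by rewrite lee_fin exprn_ge0// ltW.
apply: eq_integral => t _.
rewrite addr0 tuple_of_rowK scalerA mulVf ?gt_eqF// scale1r row_of_tupleK.
by rewrite gauss_pdf_scale muleCA -EFinM.
Qed.

(** The substitution by |h| / s turns the scaled law into a density without division by |h|, jointly
    measurable in h and t as Tonelli demands. The case h = 0 fits because [0 ^+ l] is 0 for positive
    [l]. *)
Lemma student_kernelE l n (s : R) (B : set (l.-tuple (mR R)))
    (h : n.-tuple (mR R)) : (0 < l)%N -> (0 < s)%R -> measurable B ->
  student_kernel s B h = \int[leb l]_t ((\1_B t)%:E *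
    ((tnorm h / s) ^+ l * (normal_peak 1 ^+ l *
      expR (- ((tnorm h / s) ^+ 2 * sqnorm (row_of_tuple t)) / 2)))%:E).
Proof.
move=> l0 s0 mB; rewrite /student_kernel; case: eqP => [->|/eqP h0].
  rewrite mul0r expr0n (gtn_eqF l0) integral0_eq// => t _.
  by rewrite mul0r mule0.
rewrite -scaled_gaussE//; first by rewrite invf_div.
by rewrite divr_gt0// lt_def h0 tnorm_ge0.
Qed.

Lemma student_kernel_ge0 l n (s : R) (B : set (l.-tuple (mR R)))
    (h : n.-tuple (mR R)) : 0 <= student_kernel s B h.
Proof.
rewrite /student_kernel; case: ifP => // _.
by apply: gauss_expectation_ge0 => t; rewrite lee_fin indicE.
Qed.

Lemma measurable_student_integrand l n (s : R) (B : set (l.-tuple (mR R))) :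
  measurable B ->
  measurable_fun setT (fun p : n.-tuple (mR R) * l.-tuple (mR R) =>
    (\1_B p.2)%:E * ((tnorm p.1 / s) ^+ l * (normal_peak 1 ^+ l *
      expR (- ((tnorm p.1 / s) ^+ 2 * sqnorm (row_of_tuple p.2)) / 2)))%:E : \bar R).
Proof.
move=> mB.
have mr : measurable_fun setT
    (fun p : n.-tuple (mR R) * l.-tuple (mR R) => (tnorm p.1 / s)%R : mR R).
  apply: measurable_funM; last exact: measurable_cst.
  exact: (measurableT_comp (@measurable_tnorm n) measurable_fst).
apply: emeasurable_funM.
  have mind : measurable_fun setT (fun t : l.-tuple (mR R) => (\1_B t)%:E : \bar R).
    by apply/measurable_EFinP; exact: measurable_indic.
  exact: (measurableT_comp mind measurable_snd).
apply/measurable_EFinP; apply: measurable_funM; first exact: measurable_funX.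
apply: measurable_funM; first exact: measurable_cst.
apply: (measurableT_comp (@measurable_expR R)).
apply: measurable_funM; last exact: measurable_cst.
apply: measurableT_comp => //; apply: measurable_funM; first exact: measurable_funX.
apply: measurable_sqnorm => i.
exact: (measurableT_comp (@measurable_row_coord R l i) measurable_snd).
Qed.

Lemma measurable_student_kernel l n (s : R) (B : set (l.-tuple (mR R))) :
  (0 < l)%N -> (0 < s)%R -> measurable B ->
  measurable_fun setT (@student_kernel l n s B).
Proof.
move=> l0 s0 mB; rewrite (funext (fun h : n.-tuple (mR R) => student_kernelE h l0 s0 mB)).
apply: measurable_parametric_integral; first exact: measurable_student_integrand.
move=> h t; rewrite mule_ge0 ?lee_fin ?indicE//.
by rewrite !mulr_ge0 ?exprn_ge0 ?divr_ge0 ?tnorm_ge0 ?normal_peak_ge0 ?expR_ge0// ltW.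
Qed.

Lemma student_mass_ge0 l n (s : R) : (0 < s)%R -> 0 <= student_mass l n s.
Proof.
move=> s0; apply: integral_ge0 => h _; rewrite lee_fin.
by rewrite !mulr_ge0 ?exprn_ge0 ?divr_ge0 ?tnorm_ge0 ?normal_peak_ge0
  ?gauss_pdf_ge0// ltW.
Qed.

(* Substituting h -> b h, with b^2 = 1 + |t|^2 / s^2, in the integral over h. *)
Lemma student_kernel_integral l n (s : R) (t : l.-tuple (mR R)) : (0 < s)%R ->
  \int[leb n]_h (((tnorm h / s) ^+ l * (normal_peak 1 ^+ l *
      expR (- ((tnorm h / s) ^+ 2 * sqnorm (row_of_tuple t)) / 2))) *
      gauss_pdf h)%:E =
  student_mass l n s * (student_pdf s n t)%:E.
Proof.
move=> s0; set b := Num.sqrt (1 + sqnorm (row_of_tuple t) / s ^+ 2).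
have b21 : (0 < 1 + sqnorm (row_of_tuple t) / s ^+ 2)%R.
  by rewrite ltr_pwDl// divr_ge0 ?sqnorm_ge0// sqr_ge0.
have b0 : (0 < b)%R by rewrite sqrtr_gt0.
have b2 : (b ^+ 2 = 1 + sqnorm (row_of_tuple t) / s ^+ 2)%R.
  by rewrite sqr_sqrtr// ltW.
pose H (h : n.-tuple (mR R)) : \bar R :=
  ((tnorm h / s) ^+ l * normal_peak 1 ^+ l * gauss_pdf h)%:E.
have mH : measurable_fun setT H.
  apply/measurable_EFinP; apply: measurable_funM; last exact: measurable_gauss_pdf.
  apply: measurable_funM; last exact: measurable_cst.
  apply: measurable_funX; apply: measurable_funM; last exact: measurable_cst.
  exact: measurable_tnorm.
have H0 h : 0 <= H h.
  rewrite lee_fin !mulr_ge0 ?exprn_ge0 ?divr_ge0 ?tnorm_ge0 ?normal_peak_ge0//;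
  by [exact: ltW|exact: gauss_pdf_ge0].
(* Of this power, b^(-n) cancels the Jacobian of the dilation and b^(-l) the factor b^l coming from
   |b h|^l. *)
have pdfE : student_pdf s n t = (b ^- (l + n))%R.
  rewrite /student_pdf powRN -natrD (mulrC _%:R) powRrM powR12_sqrt ?powR_mulrn//.
  exact: ltW.
have HE : student_mass l n s = (b ^+ n)%:E *
    \int[leb n]_h H (tuple_of_row (b *: row_of_tuple h)).
  rewrite /student_mass -/H (@ge0_integral_leb_affine R n b 0 _ b0 mH H0).
  by under eq_integral do rewrite addr0.
have mHb : measurable_fun setT
    (fun h : n.-tuple (mR R) => H (tuple_of_row (b *: row_of_tuple h))).
  exact: (measurableT_comp mH (measurable_scale_tuple _)).
have -> : student_mass l n s * (student_pdf s n t)%:E =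
    (b ^- l)%:E * \int[leb n]_h H (tuple_of_row (b *: row_of_tuple h)).
  rewrite HE pdfE muleAC -EFinM exprD invfM mulrCA mulfV ?mulr1//.
  by rewrite expf_neq0// gt_eqF.
rewrite -ge0_integralZl//; last by rewrite lee_fin invr_ge0 exprn_ge0// ltW.
apply: eq_integral => h _; rewrite /H -EFinM; congr EFin.
rewrite tnorm_scale; last exact: ltW.
rewrite gauss_pdf_scale b2 -(mulrA b) (exprMn _ b) /gauss_pdf.
have bl : (b ^- l * b ^+ l = 1)%R by rewrite mulVf// expf_neq0// gt_eqF.
(* The choice of b is made for this: b^2 |h|^2 is the sum of |h|^2 and (|h| / s)^2 |t|^2, the
   exponents of the two Gaussian factors. *)
have -> : (expR (- ((1 + sqnorm (row_of_tuple t) / s ^+ 2) *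
      sqnorm (row_of_tuple h)) / 2) =
    expR (- ((tnorm h / s) ^+ 2 * sqnorm (row_of_tuple t)) / 2) *
    expR (- sqnorm (row_of_tuple h) / 2))%R.
  rewrite -expRD exprMn sqr_sqrtr ?sqnorm_ge0// exprVn; congr expR.
  by ring.
move: bl; set X := (b ^+ l)%R; set u := (_ ^+ l)%R; set v := (_ ^+ l)%R.
set N := (_ ^+ n)%R; set e1 := expR _; set e2 := expR _ => bl.
rewrite [RHS](_ : _ = (X^-1 * X) * (u * (v * e1) * (N * e2)))%R; last by ring.
by rewrite bl mul1r.
Qed.

Lemma measurable_student_pdf l (s : R) n :
  measurable_fun setT (fun t : l.-tuple (mR R) => (student_pdf s n t)%:E).
Proof.
apply/measurable_EFinP.
apply: (measurableT_comp (@measurable_powR R (- ((l%:R + n%:R) / 2)))).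
apply: measurable_funD; first exact: measurable_cst.
apply: measurable_funM; last exact: measurable_cst.
by apply: measurable_sqnorm => i; exact: measurable_row_coord.
Qed.

(** Tonelli puts the integral over h inside, where [student_kernel_integral] evaluates it for each
    fixed t. *)
Lemma gauss_expectation_student_kernel l n (s : R) (B : set (l.-tuple (mR R))) :
  (0 < l)%N -> (0 < s)%R -> measurable B ->
  gauss_expectation (@student_kernel l n s B) =
  student_mass l n s * \int[leb l]_(t in B) (student_pdf s n t)%:E.
Proof.
move=> l0 s0 mB.
have mF := @measurable_student_integrand l n s B mB.
set F := (fun p => _) in mF.
have F0 p : 0 <= F p.
  rewrite mule_ge0 ?lee_fin ?indicE//.
  by rewrite !mulr_ge0 ?exprn_ge0 ?divr_ge0 ?tnorm_ge0 ?normal_peak_ge0 ?expR_ge0// ltW.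
have mFh h : measurable_fun setT (fun t => F (h, t)).
  exact: (measurableT_comp mF (pair1_measurable h)).
have mspdf := @measurable_student_pdf l s n.
have spdf0 (t : l.-tuple (mR R)) : 0 <= (student_pdf s n t)%:E.
  by rewrite lee_fin powR_ge0.
transitivity (\int[leb n]_h \int[leb l]_t (F (h, t) * (gauss_pdf h)%:E)).
  apply: eq_integral => h _; rewrite student_kernelE// ge0_integralZr//.
  by rewrite lee_fin gauss_pdf_ge0.
rewrite (@fubini_tonelli _ _ _ _ R (leb n) (leb l)
  (fun p => F p * (gauss_pdf p.1)%:E)); last 2 first.
- apply: emeasurable_funM => //.
  exact: (measurableT_comp (@measurable_EFin_gauss_pdf R n) measurable_fst).
- by move=> p; rewrite mule_ge0// lee_fin gauss_pdf_ge0.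
rewrite -ge0_integralZl//; last 2 first.
- exact: measurable_funTS.
- exact: student_mass_ge0.
rewrite [RHS]integral_mkcond; apply: eq_integral => t _.
rewrite patchE -student_kernel_integral//; case: ifPn => tB.
  by apply: eq_integral => h _; rewrite /F/= indicE tB mul1e -EFinM.
by rewrite integral0_eq// => h _; rewrite /F/= indicE (negbTE tB) !mul0e.
Qed.

End student_mixture.

(** * Identification of the mixture with the t-distribution *)

Section student_law.
Context {R : realType}.
Local Notation leb := (@lebesgue_measure_tuple R).
Local Open Scope ereal_scope.

Lemma gauss_expectation_student_kernelT l n (s : R) : (0 < l)%N -> (0 < n)%N ->
  (0 < s)%R -> gauss_expectation (@student_kernel R l n s setT) = 1.
Proof.
move=> l0; case: n => [//|n] _ s0.
have mS : measurable_fun setT (@student_kernel R l n.+1 s setT).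
  exact: measurable_student_kernel.
have F0 (t : n.+1.-tuple (mR R)) : 0 <= student_kernel s [set: l.-tuple (mR R)] t *
    (gauss_pdf t)%:E.
  by rewrite mule_ge0 ?student_kernel_ge0// lee_fin gauss_pdf_ge0.
have mF : measurable_fun setT (fun t : n.+1.-tuple (mR R) =>
    student_kernel s [set: l.-tuple (mR R)] t * (gauss_pdf t)%:E).
  by apply: emeasurable_funM => //; exact: measurable_EFin_gauss_pdf.
rewrite /gauss_expectation ge0_integral_lebS//.
rewrite -[RHS](@integral_normal_pdf R 0%R 1%R).
(* The kernel has no mass at h = 0. This point is avoided by removing the value 0 of the first
   coordinate, a null set of the line; hence n must be positive. *)
have setD0 (f : mR R -> \bar R) : measurable_fun setT f ->
    \int[lebesgue_measure]_x f x = \int[lebesgue_measure]_(x in setT `\ 0%R) f x.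
  move=> mf; apply/esym/integral_setD1; first exact: measurableD.
  exact: measurable_funTS.
rewrite (setD0 (fun x => (normal_pdf 0 1 x)%:E)); last first.
  by apply/measurable_EFinP; exact: measurable_normal_pdf.
rewrite setD0; last first.
  apply: measurable_parametric_integral => //.
  by apply: (measurableT_comp mF); exact: measurable_cons_pair.
apply: eq_integral => x; rewrite inE/= => -[_ /eqP x0].
transitivity (\int[leb n]_t ((normal_pdf 0 1 x)%:E * (gauss_pdf t)%:E)).
  apply: eq_integral => t _; rewrite gauss_pdf_cons -EFinM /student_kernel.
  rewrite ifF.
    rewrite /scaled_gauss (_ : (fun _ => _) = cst 1) ?gauss_expectation_cst ?mul1e//.
    by apply/funext => c; rewrite indicT.
  apply/negbTE; rewrite gt_eqF// sqrtr_gt0 row_of_tuple_cons.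
  rewrite [sqnorm _](@sqnorm_row_mx _ 1 n) ltr_pwDl ?sqnorm_ge0//.
  rewrite lt_def sqnorm_ge0 sqnorm_eq0 andbT.
  by apply: contraNneq x0 => /matrixP/(_ 0%R 0%R); rewrite !mxE eqxx mulr1n => ->.
rewrite ge0_integralZl ?integral_gauss_pdf ?mule1//.
- exact: measurable_EFin_gauss_pdf.
- by move=> t _; rewrite lee_fin gauss_pdf_ge0.
- by rewrite lee_fin normal_pdf_ge0.
Qed.

Lemma Gamma_ge0 (a : R) : (0 <= Gamma a)%R.
Proof. by apply: Rintegral_ge0 => x _; rewrite mulr_ge0 ?powR_ge0 ?expR_ge0. Qed.

(* The normalizing constant of t_pdf is never computed: it is nonnegative, and
   both sides have total mass 1. *)
Lemma student_law d (O : measurableType d) (Q : probability O R) l n (s : R)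
    (w : {RV Q >-> l.-tuple (mR R)}) : (0 < l)%N -> (0 < n)%N -> (0 < s)%R ->
  follows_t n%:R ((s ^+ 2 / n%:R)%:M) w ->
  forall B, measurable B ->
    Q (w @^-1` B) = gauss_expectation (@student_kernel R l n s B).
Proof.
move=> l0 n0 s0 hw.
have n0R : (n%:R != 0 :> R)%R by rewrite pnatr_eq0 -lt0n.
pose C : R := (((pi * n%:R) `^ (l%:R / 2))^-1 *
  (Gamma ((l%:R + n%:R) / 2) / Gamma (n%:R / 2)) *
  \det ((s ^+ 2 / n%:R)%:M : 'M[R]_l) `^ (- (1 / 2)))%R.
have C0 : (0 <= C)%R.
  by rewrite !mulr_ge0 ?invr_ge0 ?powR_ge0 ?Gamma_ge0.
have pdfE (t : l.-tuple (mR R)) :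
    t_pdf n%:R (s ^+ 2 / n%:R)%:M (col_of_tuple t) = (C * student_pdf s n t)%R.
  rewrite /t_pdf -/C /student_pdf; congr (_ * (_ + _) `^ _)%R.
  (* The factor 1/n in front and the n of the inverse scale matrix cancel, leaving |t|^2 / s^2; this
     explains the division by the degrees of freedom in the scale parameter. *)
  rewrite invmx_scalar mul_mx_scalar -scalemxAl mxE.
  rewrite (_ : (_ *m _) 0 0 = sqnorm (row_of_tuple t))%R; last first.
    by rewrite sqnormE mxE; apply: eq_bigr => i _; rewrite !mxE expr2.
  by rewrite mulrA invfM invrK mulrCA mulVf// mulr1 mulrC.
pose I B := \int[leb l]_(t in B) (student_pdf s n t)%:E.
have mpdf : measurable_fun setT (fun t : l.-tuple (mR R) => (student_pdf s n t)%:E).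
  exact: measurable_student_pdf.
have pdf0 (t : l.-tuple (mR R)) : 0 <= (student_pdf s n t)%:E.
  by rewrite lee_fin powR_ge0.
have QE B : measurable B -> Q (w @^-1` B) = C%:E * I B.
  move=> mB; rewrite -[LHS]/(distribution Q w B) hw// /I -ge0_integralZl//; last first.
    exact: measurable_funTS.
  by apply: eq_integral => t _; rewrite pdfE EFinM.
have QT : C%:E * I setT = 1 by rewrite -QE// preimage_setT probability_setT.
have ET : student_mass l n s * I setT = 1.
  by rewrite -gauss_expectation_student_kernel// gauss_expectation_student_kernelT.
have I0 : 0 <= I setT by exact: integral_ge0.
suff CE : C%:E = student_mass l n s.
  by move=> B mB; rewrite QE// CE -gauss_expectation_student_kernel.
have M0 := @student_mass_ge0 R l n s s0.
(* With m the mass and I the total integral, C = C (m I) = m (C I) = m, which avoids dividing by I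
   in the extended reals. *)
by rewrite -[LHS]mule1 -ET muleCA QT mule1.
Qed.

End student_law.

(** * Linear maps on flattened matrices *)

Section matrix_flattening.
Context {R : realType}.

Lemma mulmx_deltaE m n p (A : 'M[R]_(m, n)) (i : 'I_n) (j : 'I_p) k h :
  (A *m delta_mx i j) k h = A k i * (h == j)%:R.
Proof.
rewrite mxE (bigD1 i)//= mxE eqxx big1 ?addr0// => q qi.
by rewrite mxE (negbTE qi) mulr0.
Qed.

Lemma delta_mulmxE m n p (A : 'M[R]_(n, p)) (i : 'I_m) (j : 'I_n) k h :
  (delta_mx i j *m A) k h = (k == i)%:R * A j h.
Proof.
rewrite mxE (bigD1 j)//= mxE eqxx andbT big1 ?addr0// => q qj.
by rewrite mxE (negbTE qj) andbF mul0r.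
Qed.

(** In flattened coordinates left multiplication is a Kronecker product with an identity matrix, so
    transposition passes to [A]; matrix units verify it. *)
Lemma tr_lin_mulmx m n p (A : 'M[R]_(m, n)) :
  (lin_mx (mulmx A) : 'M[R]_(n * p, m * p))^T = lin_mx (mulmx A^T).
Proof.
apply/matrixP => x y; case/mxvec_indexP: x => k h; case/mxvec_indexP: y => i j.
rewrite !mxE/= !vec_mx_delta !mxvecE !mulmx_deltaE mxE.
by rewrite [j == h]eq_sym.
Qed.

Lemma tr_lin_mulmxr m n p (B : 'M[R]_(n, p)) :
  (lin_mx (mulmxr B) : 'M[R]_(m * n, m * p))^T = lin_mx (mulmxr B^T).
Proof.
apply/matrixP => x y; case/mxvec_indexP: x => k h; case/mxvec_indexP: y => i j.
rewrite !mxE/= !vec_mx_delta !mxvecE !delta_mulmxE mxE.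
by rewrite [i == k]eq_sym.
Qed.

(** Row vectors are multiplied from the right, so the left factor acts first: X goes to A^T X, then
    to A A^T X. *)
Lemma lin_mulmx_comp m n (A : 'M[R]_(m, n)) p :
  (lin_mx (mulmx A) : 'M[R]_(n * p, m * p))^T *m lin_mx (mulmx A) =
  lin_mx (mulmx (A *m A^T)).
Proof.
apply/row_matrixP => i; rewrite !rowE tr_lin_mulmx mulmxA !mul_rV_lin/=.
by rewrite mxvecK mulmxA.
Qed.

Lemma lin_mulmxr_orthonormal m n p (B : 'M[R]_(n, p)) : B^T *m B = 1%:M ->
  (lin_mx (mulmxr B) : 'M[R]_(m * n, m * p))^T *m lin_mx (mulmxr B) = 1%:M.
Proof.
move=> BB; apply/row_matrixP => i; rewrite !rowE tr_lin_mulmxr mulmxA !mul_rV_lin/=.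
by rewrite mxvecK -mulmxA BB !mulmx1 vec_mxK.
Qed.

(** Represents X -> (X k)^T on flattened matrices. For a unit vector [k] its columns are
    orthonormal, so a Gaussian matrix applied to [k] is a standard Gaussian vector. *)
Definition apply_col_mx m n (k : 'cV[R]_n) : 'M[R]_(m * n, m) :=
  lin1_mx (trmx \o mulmxr k \o vec_mx).

Lemma apply_col_mxE m n (k : 'cV[R]_n) (v : 'rV[R]_(m * n)) :
  v *m apply_col_mx m k = (vec_mx v *m k)^T.
Proof. by rewrite mul_rV_lin1. Qed.

Lemma apply_col_mx_orthonormal m n (k : 'cV[R]_n) : k^T *m k = 1%:M ->
  (apply_col_mx m k)^T *m apply_col_mx m k = 1%:M.
Proof.
move=> kk.
have -> : (apply_col_mx m k)^T = lin1_mx (mxvec \o mulmxr k^T \o trmx).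
  apply/matrixP => j x; case/mxvec_indexP: x => a b.
  rewrite 2![LHS]mxE/= vec_mx_delta [LHS]mxE delta_mulmxE.
  by rewrite [RHS]mxE/= mxvecE trmx_delta delta_mulmxE mxE eq_sym.
apply/row_matrixP => i; rewrite !rowE mulmxA apply_col_mxE mul_rV_lin1/=.
by rewrite mxvecK -mulmxA kk !mulmx1 trmxK.
Qed.

End matrix_flattening.

(** * The lower bound from the block splitting of a Gaussian matrix *)

Section gaussian_matrix_bound.
Context {R : realType}.
Local Open Scope ereal_scope.

(** Each block contributes left multiplication by M M^T, and these sum to the identity. The rotation
    runs from the blocks to the full matrix, and as orthonormal columns suffice, e + k + l and D are
    never identified in the types. *)
Lemma block_rotation_orthonormal D e k l d (M1 : 'M[R]_(D, e)) (M2 : 'M[R]_(D, k))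
    (M3 : 'M[R]_(D, l)) :
  (M1 *m M1^T + (M2 *m M2^T + M3 *m M3^T) = 1%:M)%R ->
  let J : 'M[R]_(e * d + (k * d + l * d), D * d) := col_mx (lin_mx (mulmx M1))
    (col_mx (lin_mx (mulmx M2)) (lin_mx (mulmx M3))) in
  (J^T *m J = 1%:M)%R.
Proof.
move=> MM J; rewrite /J !tr_col_mx !mul_row_col !lin_mulmx_comp.
apply/row_matrixP => i; rewrite !rowE !mulmxDr !mul_rV_lin/= -!linearD -!mulmxDl.
by rewrite MM mul1mx/= vec_mxK mulmx1.
Qed.

Lemma block_rotationE D e k l d (M1 : 'M[R]_(D, e)) (M2 : 'M[R]_(D, k))
    (M3 : 'M[R]_(D, l)) (r : 'rV_(e * d)) (b : 'rV_(k * d)) (c : 'rV_(l * d)) :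
  vec_mx (row_mx r (row_mx b c) *m col_mx (lin_mx (mulmx M1))
    (col_mx (lin_mx (mulmx M2)) (lin_mx (mulmx M3)))) =
  (M1 *m vec_mx r + (M2 *m vec_mx b + M3 *m vec_mx c))%R.
Proof. by rewrite !mul_row_col !mul_rV_lin/= -!linearD/= mxvecK. Qed.

(* For fixed r, the rows of G are an orthonormal basis of a space orthogonal to
   the rows of r; the witness y = s G^T h^T / |h|^2 with h = b G^T solves
   r y = 0 and b y = s. *)
Lemma gauss_prob_ge_student D e l d n (s : R) (M1 : 'M[R]_(D, e))
    (M2 : 'M[R]_(D, 1)) (M3 : 'M[R]_(D, l)) (S : set 'M[R]_(D, d))
    (B : set (l.-tuple (mR R))) :
  (e + n <= d)%N -> (0 < l)%N -> (0 < s)%R ->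
  (M1 *m M1^T + (M2 *m M2^T + M3 *m M3^T) = 1%:M)%R ->
  measurable B ->
  measurable [set t : (D * d).-tuple (mR R) | S (vec_mx (row_of_tuple t))] ->
  (forall (r : 'M[R]_(e, d)) (b : 'M[R]_(1, d)) (c : 'M[R]_(l, d)) (y : 'cV[R]_d),
    r *m y = 0 -> b *m y = s%:M -> B (tuple_of_row (c *m y)^T) ->
    S (M1 *m r + (M2 *m b + M3 *m c)))%R ->
  gauss_expectation (@student_kernel R l n s B) <=
  gauss_prob [set t : (D * d).-tuple (mR R) | S (vec_mx (row_of_tuple t))].
Proof.
move=> end_ l0 s0 MM mB mS Ssol.
rewrite gauss_probE//.
set S' := [set t | _]; set J : 'M[R]_(e * d + (1 * d + l * d), D * d) :=
  col_mx (lin_mx (mulmx M1)) (col_mx (lin_mx (mulmx M2)) (lin_mx (mulmx M3))).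
have JJ : (J^T *m J = 1%:M)%R by exact: block_rotation_orthonormal.
pose g (t : (e * d + (1 * d + l * d)).-tuple (mR R)) : \bar R :=
  (\1_S' (tuple_of_row (row_of_tuple t *m J)))%:E.
have mind : measurable_fun setT (fun t => (\1_S' t)%:E : \bar R).
  by apply/measurable_EFinP; exact: measurable_indic.
have mg : measurable_fun setT g.
  by apply: (measurableT_comp mind); exact: measurable_mulmx_tuple.
have g0 t : 0 <= g t by rewrite lee_fin indicE.
have indS0 t : 0 <= (\1_S' t)%:E :> \bar R by rewrite lee_fin indicE.
rewrite -(gauss_expectation_orthonormal JJ mind indS0) -/g.
rewrite (@gauss_expectation_cat R (e * d) (1 * d + l * d) g mg g0).
set K := gauss_expectation (@student_kernel R l n s B).
have mgr (r : (e * d).-tuple (mR R)) :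
    measurable_fun setT (fun t : (1 * d + l * d).-tuple (mR R) => g [tuple of r ++ t])
  by exact: measurable_fun_cat.
have K0 : 0 <= K by apply: gauss_expectation_ge0 => h; exact: student_kernel_ge0.
(* Writing [K] as the expectation of a constant in [r] reduces the claim to a bound for each [r], so
   [G] may depend on [r] arbitrarily. *)
rewrite -[leLHS](@gauss_expectation_cst R (e * d) K K0).
apply: le_gauss_expectation => //.
  apply: measurable_gauss_expectation => [|x y //].
  by apply: (measurableT_comp mg); exact: measurable_cat_tuple.
move=> r; rewrite (@gauss_expectation_cat R (1 * d) (l * d) _ (mgr r))//.
have [G [GG rG]] := exists_orthonormal_rows (vec_mx (row_of_tuple r)) end_.
(* The flattened map b -> b G^T. Its values have length [1 * n], hence the rewriting of [n] in [K]
   below. *)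
pose Qb : 'M[R]_(1 * d, 1 * n) := lin_mx (mulmxr G^T).
have QQb : (Qb^T *m Qb = 1%:M)%R by apply: lin_mulmxr_orthonormal; rewrite trmxK.
have mk : measurable_fun setT (@student_kernel R l (1 * n) s B).
  exact: measurable_student_kernel.
rewrite /K -[X in gauss_expectation (@student_kernel _ _ X _ _)](mul1n n).
rewrite -(gauss_expectation_orthonormal QQb mk (@student_kernel_ge0 _ _ _ s B)).
apply: le_gauss_expectation.
- by apply: (measurableT_comp mk); exact: measurable_mulmx_tuple.
- apply: measurable_gauss_expectation => [|x y //].
  by apply: (measurableT_comp (mgr r)); exact: measurable_cat_tuple.
- by move=> b; exact: student_kernel_ge0.
move=> b; rewrite /student_kernel; case: eqP => [_|/eqP h0].
  by apply: gauss_expectation_ge0.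
pose h := (vec_mx (row_of_tuple b) *m G^T)%R : 'rV[R]_n.
have bQ : (row_of_tuple b *m Qb = mxvec h)%R by rewrite mul_rV_lin.
have sqmxvec : sqnorm (mxvec h) = sqnorm h.
  rewrite !sqnormE (reindex _ (curry_mxvec_bij _ _))/=.
  rewrite (reindex (fun j : 'I_n => (0%R : 'I_1, j))) /=.
    by apply: eq_bigr => j _; rewrite mxvecE.
  by exists snd => // -[i j] _ /=; rewrite (ord1 i).
rewrite /tnorm tuple_of_rowK bQ sqmxvec in h0 *.
set rho := Num.sqrt (sqnorm h) in h0 *.
have rho0 : (0 < rho)%R by rewrite lt_def h0 sqrtr_ge0.
have hh : (h *m h^T = (rho ^+ 2)%:M)%R.
  by rewrite [LHS]mx11_scalar -/(sqnorm h) sqr_sqrtr// sqnorm_ge0.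
(* The unit vector along the witness, which is (s / rho) k. It depends on [r] and [b] alone, so for
   fixed [r] and [b] the product c k is standard Gaussian. *)
pose k : 'cV[R]_d := (rho^-1 *: (G^T *m h^T))%R.
have kk : (k^T *m k = 1%:M)%R.
  rewrite /k [(_ *: _)^T%R]linearZ/= trmx_mul !trmxK -scalemxAl -scalemxAr scalerA.
  rewrite mulmxA -(mulmxA h) GG mulmx1 hh -expr2 exprVn scale_scalar_mx.
  by rewrite mulVf// sqrf_eq0.
rewrite /scaled_gauss.
pose fB (t : l.-tuple (mR R)) : \bar R :=
  (\1_B (tuple_of_row ((s / rho) *: row_of_tuple t)))%:E.
have mfB : measurable_fun setT fB.
  have mi : measurable_fun setT (fun t => (\1_B t)%:E : \bar R).
    by apply/measurable_EFinP; exact: measurable_indic.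
  by apply: (measurableT_comp mi); exact: measurable_scale_tuple.
have fB0 t : 0 <= fB t by rewrite lee_fin indicE.
rewrite -/fB -(gauss_expectation_orthonormal (apply_col_mx_orthonormal l kk) mfB fB0).
apply: le_gauss_expectation => //.
- by apply: (measurableT_comp mfB); exact: measurable_mulmx_tuple.
- exact: (measurable_fun_cat b (mgr r)).
(* The comparison is now pointwise: wherever the indicator of [B] is 1, the witness shows that the
   assembled matrix lies in [S]. *)
move=> c; rewrite /fB lee_fin indicE.
case: (boolP (_ \in B)) => [|_]; last by rewrite indicE.
rewrite inE tuple_of_rowK apply_col_mxE => Bc.
rewrite [leRHS](_ : _ = 1)%R//; rewrite indicE mem_set//.
rewrite /S'/= tuple_of_rowK !row_of_tuple_cat block_rotationE.
apply: (Ssol _ _ _ ((s / rho) *: k)%R).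
- by rewrite -scalemxAr /k -scalemxAr mulmxA rG mul0mx !scaler0.
- rewrite -scalemxAr /k -scalemxAr mulmxA -/h hh !scale_scalar_mx; congr (_%:M)%R.
  by field.
- by rewrite -scalemxAr linearZ.
Qed.

End gaussian_matrix_bound.

(** * Orthogonal frames and the event of success *)

Section reduced_problem.
Context {R : realType}.

Lemma continuous_sum (X : topologicalType) (I : finType) (F : I -> X -> R) :
  (forall i, continuous (F i)) -> continuous (fun x => \sum_i F i x).
Proof.
move=> Fc; apply: (@continuous_big R I +%R 0 xpredT) => [|i _]; last exact: Fc.
exact: (@add_continuous R^o).
Qed.

(** The rows of [v] and [G] together form a square matrix, for which orthonormal rows imply
    orthonormal columns. *)
Lemma complete_unit_row e (v : 'rV[R]_(1 + e)) : v *m v^T = 1%:M ->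
  exists G : 'M[R]_(e, 1 + e), v^T *m v + G^T *m G = 1%:M.
Proof.
move=> vv; have [G [GG vG]] := exists_orthonormal_rows v (leqnn (1 + e)%N).
exists G; rewrite -mul_row_col -tr_col_mx; apply: mulmx1C.
rewrite tr_col_mx mul_col_row vv vG GG -[G *m v^T]trmxK trmx_mul trmxK vG trmx0.
by rewrite -scalar_mx_block.
Qed.

Section subspaces.
Variables (D de : nat) (U : 'M[R]_(D, de)) (V : 'M[R]_(D, D - de)).
Hypotheses (deD : (de <= D)%N) (hU : orthonormal_columns U)
  (hV : orthonormal_columns V).
Hypothesis hUV : [set x | x \in colspan V] = orthogonal_complement (colspan U).

Lemma col_colspan k (M : 'M[R]_(D, k)) j : col j M \in colspan M.
Proof. by apply: memv_span; apply: map_f; rewrite mem_enum. Qed.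

Lemma mulmx_colspan k (M : 'M[R]_(D, k)) (x : 'cV[R]_k) : M *m x \in colspan M.
Proof.
rewrite (_ : M *m x = \sum_j x j 0 *: col j M).
  by apply: memv_suml => j _; apply: memvZ; exact: col_colspan.
apply/colP => i; rewrite mxE summxE; apply: eq_bigr => j _.
by rewrite !mxE mulrC.
Qed.

Lemma tr_mulmx_complement : U^T *m V = 0.
Proof.
apply/matrixP => i j; rewrite [RHS]mxE.
have : orthogonal_complement (colspan U) (col j V).
  by rewrite -hUV /=; exact: col_colspan.
move=> /(_ (col i U) (col_colspan _ _)) <-.
by rewrite /dotmul !mxE; apply: eq_bigr => k _; rewrite !mxE.
Qed.

Lemma projectionD : U *m U^T + V *m V^T = 1%:M.
Proof.
have UV := tr_mulmx_complement.
(* After D is replaced by [de + l], the matrix formed by U and V is square, and its left inverse is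
   also a right inverse. *)
move: (D - de)%N (subnKC deD) V hV UV => l Dl V' hV' UV'.
move: D Dl U V' hU hV' UV' => D' <- U' V' hU' hV' UV'.
rewrite -mul_row_col -tr_row_mx; apply: mulmx1C.
rewrite tr_row_mx mul_col_row hU' hV' UV' -[V'^T *m U']trmxK trmx_mul trmxK UV'.
by rewrite trmx0 -scalar_mx_block.
Qed.

End subspaces.

(** Optimality and feasibility are encoded as the vanishing of one continuous nonnegative function
    of the point A y + p, which brings the event into the form of [measurable_exists_zero]. *)
Lemma measurable_reduced_problem_successful D d (f : 'cV[R]_D -> R) (fstar : R)
    (p : 'cV[R]_D) : continuous f ->
  measurable [set t : (D * d).-tuple (mR R) |
    reduced_problem_successful f (cube D) fstar (vec_mx (row_of_tuple t)) p].
Proof.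
move=> fc.
(* The second summand vanishes exactly on the cube, since a + |a| = 0 iff a <= 0. *)
pose excess (x : 'cV[R]_D) i : R := `|x i 0| - 1 + `| `|x i 0| - 1 |.
pose F (x : 'cV[R]_D) : R := `|f x - fstar| + \sum_i excess x i.
have excess_ge0 x i : 0 <= excess x i.
  by have := ler_norm (- (`|x i 0| - 1)); rewrite normrN /excess; lra.
have Fpos x : 0 <= \sum_i excess x i by apply: sumr_ge0 => i _; exact: excess_ge0.
have F0 x : 0 <= F x by rewrite addr_ge0.
have absc (h : 'cV[R]_D -> R) (c : R) : continuous h ->
    continuous (fun x => `|h x - c|).
  move=> hc x.
  have hB : (fun z => h z - c) z @[z --> x] --> h x - c.
    exact: cvgB (hc x) (cvg_cst c).
  exact: (@continuous_cvg _ _ _ _ _ (fun z => h z - c) (fun r : R => `|r|) _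
    (@norm_continuous _ R^o _) hB).
have Fc : continuous F.
  have sc : continuous (fun x : 'cV[R]_D => \sum_i excess x i).
    apply: continuous_sum => i x.
    have ax : continuous (fun x : 'cV[R]_D => `|x i 0| : R).
      have := @absc (fun x => x i 0) 0 (@coord_continuous _ _ _ i 0).
      by under eq_fun do rewrite subr0.
    have ax1 : (fun y : 'cV[R]_D => `|y i 0| - 1 : R) y @[y --> x] --> (`|x i 0| - 1 : R).
      exact: cvgB (ax x) (cvg_cst (1 : R)).
    exact: cvgD ax1 (absc _ 1 ax x).
  by move=> x; exact: cvgD (absc f fstar fc x) (sc x).
have FE x : F x = 0 <-> f x = fstar /\ cube D x.
  split=> [/eqP|[fx cx]].
    rewrite paddr_eq0// normr_eq0 subr_eq0 => /andP[/eqP fx].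
    rewrite psumr_eq0 => [/allP xc|i _]; last exact: excess_ge0.
    split => // i; have /(_ (mem_index_enum _))/implyP/(_ isT) := xc i.
    rewrite /excess addrC addr_eq0 => /eqP xi.
    by rewrite -ler_norml -subr_le0 -oppr_ge0 -xi.
  rewrite /F fx subrr normr0 add0r big1// => i _.
  have := cx i; rewrite -ler_norml -subr_le0 => xi.
  by rewrite /excess (ler0_norm xi) subrr.
pose phi (t : (D * d).-tuple (mR R)) (y : 'rV[R]_d) :=
  vec_mx (row_of_tuple t) *m y^T + p.
rewrite (_ : [set t | _] = [set t | exists y, F (phi t y) = 0]); last first.
  apply/seteqP; split => t /=.
    by move=> [y [fy cy]]; exists y^T; apply/FE; rewrite /phi trmxK.
  by move=> [y /FE[fy cy]]; exists y^T.
have phic t : continuous (phi t).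
  apply: continuous_mx_coord => i j.
  have sc : continuous (fun y : 'rV[R]_d => \sum_k vec_mx (row_of_tuple t) i k * y j k).
    apply: continuous_sum => k y.
    exact: cvgM (cvg_cst _) (@coord_continuous _ _ _ j k y).
  rewrite (_ : (fun _ => _) = (fun y : 'rV[R]_d =>
      \sum_k vec_mx (row_of_tuple t) i k * y j k + p i j)); last first.
    by apply/funext => y; rewrite !mxE; congr (_ + _);
      apply: eq_bigr => k _; rewrite !mxE.
  by move=> y; exact: cvgD (sc y) (cvg_cst _).
apply: measurable_exists_zero => [t y|y|t y]; last exact: F0.
  exact: (@continuous_comp _ _ _ (phi t) F y (phic t y) (Fc _)).
apply: measurable_continuous_mx => // i j.
under eq_fun do rewrite mxE.
apply: measurable_funD; last exact: measurable_cst.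
under eq_fun do rewrite mxE.
apply: (@measurable_sum _ _ R) => k.
apply: measurable_funM; last exact: measurable_cst.
under eq_fun do rewrite mxE.
exact: measurable_row_coord.
Qed.

(** The entries are enumerated in the order of [mxvec], so that [vec_mx] recovers the random matrix
    from the tuple. *)
Lemma random_matrix_law d (O : measurableType d) (P : probability O R) m n
    (A : 'I_m * 'I_n -> {RV P >-> mR R}) (S : set 'M[R]_(m, n)) :
  gaussian_matrix A ->
  measurable [set t : (m * n).-tuple (mR R) | S (vec_mx (row_of_tuple t))] ->
  P [set om | S (random_matrix A om)] =
  gauss_prob [set t : (m * n).-tuple (mR R) | S (vec_mx (row_of_tuple t))].
Proof.
move=> [indA normA] mS.
have [e e1 e2] := @curry_mxvec_bij m n.
have be : bijective e.
  exists (uncurry (@mxvec_index m n)).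
    by move=> i; rewrite e2.
  by move=> i; rewrite e1.
rewrite -(gaussian_family_law be indA normA mS).
congr (P _); apply/seteqP; suff E om : random_matrix A om =
    vec_mx (row_of_tuple [tuple (A (e i) om : mR R) | i < m * n]).
  by split => om /=; rewrite E.
apply/matrixP => i j; rewrite mxE [RHS]mxE mxE tnth_mktuple.
by congr (A _ _); have /= := e1 (i, j); move=> ->.
Qed.

End reduced_problem.

Section rotated_frame.
Context {R : realType}.

(** An orthonormal completion of [v] in coordinates is carried by U into the effective subspace. A
    unit row cannot be empty, which yields [de = e.+1]. *)
Lemma exists_rotated_frame D de (U : 'M[R]_(D, de)) (v : 'rV[R]_de) :
  v *m v^T = 1%:M -> exists e (M : 'M[R]_(D, e)), de = e.+1 /\
    M *m M^T + (U *m v^T) *m (U *m v^T)^T = U *m U^T.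
Proof.
case: de U v => [|e] U v vv.
  have /matrixP/(_ 0 0)/eqP := vv.
  by rewrite mxE big_ord0 mxE eqxx eq_sym oner_eq0.
have [G GG] := @complete_unit_row R e v vv.
exists e, (U *m G^T); split => //.
rewrite !trmx_mul !trmxK -(mulmxA U) -(mulmxA U v^T) -mulmxDr.
by rewrite (mulmxA G^T) (mulmxA v^T) -mulmxDl addrC GG mul1mx.
Qed.

End rotated_frame.

Theorem corollary3p4 (R : realType) (D d de : nat)
    (hdeD : (de < D)%N) (hded : (de <= d)%N)
    (f : 'cV[R]_D -> R) (hfcont : continuous f)
    (hfde : effective_dimension f de)
    (T : {vspace 'cV[R]_D}) (hT : effective_subspace f de T)
    (U : 'M[R]_(D, de)) (V : 'M[R]_(D, D - de))
    (hU : orthonormal_columns U) (hV : orthonormal_columns V)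
    (hUT : colspan U = T)
    (hVT : [set x | x \in colspan V] = orthogonal_complement T)
    (fstar : R) (hfstar : minimum_value f (cube D) fstar)
    (xstar : 'cV[R]_D) (hxstar : global_minimizer f (cube D) xstar)
    (p : 'cV[R]_D) (hp : cube D p)
    (dO : measure_display) (O : measurableType dO) (P : probability O R)
    (A : 'I_D * 'I_d -> {RV P >-> measurableTypeR R}) (hA : gaussian_matrix A)
    (hpx : projection U p <> projection U xstar)
    (dO' : measure_display) (O' : measurableType dO') (Q : probability O' R)
    (w : {RV Q >-> (D - de).-tuple (measurableTypeR R)})
    (hw : let nu := (d - de + 1)%:R in
          follows_t nu
            ((enorm (projection U xstar - projection U p) ^+ 2 / nu)%:M) w) :
  (Q [set om | forall i,
        (-1 <= (projection U xstar + projection V p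
                + V *m col_of_tuple (w om)) i 0 <= 1)%R]
   <= P [set om | reduced_problem_successful f (cube D) fstar
                    (random_matrix A om) p])%E.
Proof.
set px := projection U xstar in hpx hw *.
set pp := projection V p.
pose a : 'cV[R]_de := U^T *m (xstar - p).
have Ua : px - projection U p = U *m a.
  by rewrite /px /projection /a mulmxA mulmxBr.
have a0 : a != 0.
  apply/eqP => a0; apply: hpx; apply/esym/eqP.
  by rewrite -subr_eq0 Ua a0 mulmx0.
pose s := Num.sqrt (sqnorm a^T).
have sE : enorm (px - projection U p) = s.
  rewrite /enorm /s Ua /dotmul /sqnorm trmxK trmx_mul mulmxA -(mulmxA a^T).
  by rewrite hU mulmx1.
have sqa0 : 0 < sqnorm a^T.
  rewrite lt_def sqnorm_ge0 andbT sqnorm_eq0.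
  by apply: contra a0 => /eqP /(congr1 trmx); rewrite trmxK trmx0 => ->.
have s0 : 0 < s by rewrite sqrtr_gt0.
rewrite -hUT in hVT hT.
have UV : U *m U^T + V *m V^T = 1%:M.
  exact: projectionD (ltnW hdeD) hU hV hVT.
have ppE x : x - projection U x = projection V x.
  by rewrite -[X in X - _]mul1mx -UV mulmxDl addrAC subrr add0r.
have fproj x (z : 'cV[R]_(D - de)) : f (projection U x + V *m z) = f (projection U x).
  apply: hT.2; first by rewrite /projection -mulmxA; exact: mulmx_colspan.
  by rewrite -hVT /=; exact: mulmx_colspan.
(* The point [px] may lie outside the cube; it has the optimal value because [xstar] differs from it
   by a vector of the constant subspace. *)
have fxs : f px = fstar.
  have -> : f px = f xstar.
    rewrite -(fproj xstar (V^T *m xstar)) mulmxA -/(projection V xstar) -ppE.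
    by rewrite addrC subrK.
  have [[z cz fz] lb] := hfstar; apply/eqP; rewrite eq_le; apply/andP; split.
    by rewrite -fz; exact: hxstar.2.
  by apply: lb; exists xstar => //; exact: hxstar.1.
pose B : set ((D - de).-tuple (mR R)) := [set t | forall i,
  -1 <= (px + pp + V *m col_of_tuple t) i 0 <= 1].
have mB : measurable B.
  rewrite (_ : B = \bigcap_(i in [set: 'I_D])
      ((fun t => (px + pp + V *m col_of_tuple t) i 0) @^-1` [set` `[-1, 1]])).
    apply: fin_bigcap_measurable => // i _.
    rewrite -[X in measurable X]setTI.
    suff : measurable_fun setT (fun t : (D - de).-tuple (mR R) =>
        (px + pp + V *m col_of_tuple t) i 0 : mR R).
      by apply => //; exact: measurable_itv.
    under eq_fun do rewrite mxE.
    apply: measurable_funD; first exact: measurable_cst.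
    under eq_fun do rewrite mxE.
    apply: (@measurable_sum _ _ R) => k.
    apply: measurable_funM; first exact: measurable_cst.
    by under eq_fun do rewrite mxE; exact: measurable_tnth.
  by apply/seteqP; split => t h i => [_|]; have := h i; rewrite /= in_itv/= => //; exact.
rewrite sE in hw.
have n0 : (0 < d - de + 1)%N by rewrite addn1.
have l0 : (0 < D - de)%N by rewrite subn_gt0.
rewrite [leLHS](student_law l0 n0 s0 hw mB).
have mS := measurable_reduced_problem_successful (d := d) fstar p hfcont.
rewrite [leRHS](random_matrix_law hA (S := fun M =>
  reduced_problem_successful f (cube D) fstar M p) mS).
have vv : (s^-1 *: a^T) *m (s^-1 *: a^T)^T = 1%:M.
  rewrite [LHS]mx11_scalar -/(sqnorm _) sqnormZ exprVn sqr_sqrtr ?sqnorm_ge0//.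
  by rewrite mulVf// gt_eqF.
have [e [M [deE MM]]] := exists_rotated_frame U vv.
(* With [de = e.+1] and [de <= d] this is an equality: the rows of [r] and of [G] together exactly
   exhaust dimension d. *)
have end_ : (e + (d - de + 1) <= d)%N by lia.
apply: (@gauss_prob_ge_student R D e (D - de) d (d - de + 1) s M
  (U *m (s^-1 *: a^T)^T) V
  (fun M => reduced_problem_successful f (cube D) fstar M p)
  B end_ l0 s0 _ mB mS).
  by rewrite addrA MM.
move=> r b c y ry bys Bcy; exists y.
set X := _ *m y + p.
(* The conditions on [r] and [b] move the effective part of p exactly onto that of [xstar]; what
   remains lies in the range of V, where [fproj] makes f constant. *)
have XE : X = px + V *m (V^T *m p + c *m y).
  rewrite /X !mulmxDl -!mulmxA ry bys mulmx0 add0r mul_mx_scalar.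
  rewrite -scalemxAr linearZ/= trmxK.
  have -> : s *: (U *m (s^-1 *: a)) = px - projection U p.
    by rewrite Ua -scalemxAr scalerA mulfV ?scale1r// gt_eqF.
  rewrite mulmxDr (mulmxA V V^T) -/(projection V p) -ppE -!addrA.
  by congr (_ + _); rewrite addrA addrC.
split; first by rewrite XE fproj.
move=> i; have := Bcy i; rewrite XE mulmxDr (mulmxA V V^T) -/(projection V p) addrA.
rewrite (_ : col_of_tuple _ = c *m y)//.
by apply/colP => j; rewrite mxE tnth_mktuple mxE.
Qed.
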